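(* Consider the sparse normal means model: one observes $X=(X_1,\ldots,X_n)$ with $X_i=\theta_i+\varepsilon_i$, $\varepsilon_i$ i.i.d. $\mathcal{N}(0,1)$, with $P_\theta,E_\theta$ the law of $X$ and expectation under $\theta$, and $\ell_0[s_n]=\{\theta\in\mathbb{R}^n:\#\{i:\theta_i\ne0\}\le s_n\}$; set $r_n=2s_n\log(n/s_n)$. Let $\Pi_\alpha=\bigotimes_{i=1}^n((1-\alpha)\delta_0+\alpha G)$ be the spike and slab prior with slab $G$ the standard Cauchy distribution (density $\gamma(x)=\frac{1}{\pi(1+x^2)}$), and let $\Pi_{\hat\alpha}[\cdot\mid X]$ be the plug-in posterior, where $\hat\alpha$ maximises over $[\alpha_n,1]$ the log-marginal likelihood $\ell_n(\alpha)=\sum_{i=1}^n\log((1-\alpha)\phi(X_i)+\alpha g(X_i))$, with $\phi$ the standard normal density, $g=\phi*\gamma$, and $\alpha_n$ defined by $t(\alpha_n)=\sqrt{2\log n}$. Then there exist $C>0$, $N_0>0$ and $c_0,c_1>0$ such that for any $n\ge N_0$ and any $s_n$ with $c_1\log^2 n\le s_n\le c_0 n$, \[ \sup_{\theta_0\in\ell_0[s_n]}E_{\theta_0}\int\|\theta-\theta_0\|^2\,d\Pi_{\hat\alpha}(\theta\mid X)\le C r_n. \] If one only assumes $1\le s_n\le c_0 n$, the same statement holds with the bound $Cr_n$ replaced by $Cr_n+C\log^3 n$.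
   Context: For fixed $\alpha$, the posterior is $\Pi_\alpha[\cdot\mid X]=\bigotimes_{i=1}^n((1-a(X_i))\delta_0+a(X_i)G_{X_i})$ with $a(x)=\frac{\alpha g(x)}{(1-\alpha)\phi(x)+\alpha g(x)}$ and $G_x$ of density $\gamma_x(u)=\phi(x-u)\gamma(u)/g(x)$; $\Pi_{\hat\alpha}[\cdot\mid X]$ is this with $\alpha=\hat\alpha$. The threshold $t(\alpha)>0$ is the posterior median threshold for fixed $\alpha$: the coordinatewise posterior median of $\theta_i$ is $0$ iff $|X_i|\le t(\alpha)$; $t(\cdot)$ is continuous and strictly decreasing. $\|\cdot\|$ is the Euclidean norm. *)

(* Defs.v *)
From HB Require Import structures.
From mathcomp Require Import all_boot all_order all_algebra.
From mathcomp Require Import all_classical all_reals all_analysis.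
Set Implicit Arguments. Unset Strict Implicit. Unset Printing Implicit Defensive.
Import Order.TTheory GRing.Theory Num.Theory.
Import numFieldNormedType.Exports.
Local Open Scope classical_set_scope.
Local Open Scope ring_scope.

Section SpikeSlab.
Variable R : realType.

Notation leb := (@lebesgue_measure R).

Definition phi (x : R) : R := expR (- (x ^+ 2) / 2) / Num.sqrt (2 * pi).

Definition gam (x : R) : R := 1 / (pi * (1 + x ^+ 2)).

Definition gconv (x : R) : R := Rintegral leb setT (fun u => phi (x - u) * gam u).

Definition apost (alpha x : R) : R :=
  alpha * gconv x / ((1 - alpha) * phi x + alpha * gconv x).

Definition gamx (x u : R) : R := phi (x - u) * gam u / gconv x.

(* "the coordinatewise posterior median is 0 at observation x":
   0 is a median of (1-a(x)) delta_0 + a(x) G_x, i.e.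
   Pi(theta < 0 | x) <= 1/2 and Pi(theta > 0 | x) <= 1/2. *)
Definition postmed_zero (alpha x : R) : Prop :=
  ((apost alpha x)%:E * \int[leb]_(u in [set u : R | (u < 0)%R]) (gamx x u)%:E <= (2^-1)%:E)%E /\
  ((apost alpha x)%:E * \int[leb]_(u in [set u : R | (0 < u)%R]) (gamx x u)%:E <= (2^-1)%:E)%E.

Definition is_threshold (alpha t : R) : Prop :=
  0 < t /\ forall x : R, postmed_zero alpha x <-> `|x| <= t.

Definition loglik (n : nat) (alpha : R) (X : nat -> R) : R :=
  \sum_(i < n) ln ((1 - alpha) * phi (X i) + alpha * gconv (X i)).

(* integral of (u - t)^2 against the coordinate posterior
   (1 - a(x)) delta_0 + a(x) G_x *)
Definition post_sq (alpha x t : R) : \bar R :=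
  (((1 - apost alpha x) * t ^+ 2)%:E
   + (apost alpha x)%:E * \int[leb]_(u in setT) (((u - t) ^+ 2) * gamx x u)%:E)%E.

(* int ||theta - theta0||^2 dPi_alpha(theta | X), the posterior being the
   product of the coordinate posteriors *)
Definition post_risk (n : nat) (alpha : R) (theta0 X : nat -> R) : \bar R :=
  (\sum_(i < n) post_sq alpha (X i) (theta0 i))%E.

Definition upd (X : nat -> R) (k : nat) (y : R) : nat -> R :=
  fun j => if j == k then y else X j.

Fixpoint gauss_iter (m : nat) (theta : nat -> R) (F : (nat -> R) -> \bar R)
    (X : nat -> R) : \bar R :=
  match m with
  | 0 => F X
  | m'.+1 => \int[leb]_(y in setT)
               ((phi (y - theta m'))%:E * gauss_iter m' theta F (upd X m' y))%E
  end.

(* E_theta F(X) for X = theta + eps, eps ~ N(0, I_n), F nonnegative *)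
Definition Eth (n : nat) (theta : nat -> R) (F : (nat -> R) -> \bar R) : \bar R :=
  gauss_iter n theta F (fun _ => 0).

Definition in_l0 (n s : nat) (theta : nat -> R) : Prop :=
  (#|[set i : 'I_n | theta i != 0%R]| <= s)%N.

Definition rate (n s : nat) : R := 2 * s%:R * ln (n%:R / s%:R).

End SpikeSlab.

(* Main.v *)
Require Import Defs.
From HB Require Import structures.
From mathcomp Require Import all_boot all_order all_algebra.
From mathcomp Require Import all_classical all_reals all_analysis.
From mathcomp Require Import measurable_realfun ring lra.
Import Order.TTheory GRing.Theory Num.Theory.
Import numFieldNormedType.Exports.
Set Implicit Arguments.
Unset Strict Implicit.
Unset Printing Implicit Defensive.
Local Open Scope ring_scope.

(** Write [q_a = (1-a) phi + a g] and [r_a = g / q_a]. Comparing the likelihood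
    at [ahat] with its value at another weight through [ln y <= y - 1] gives
    [sum_i r_b(X_i) <= n] for [b > ahat] and [sum_i r_a(X_i) >= n] for
    [a < ahat], without any derivative.

    Signals are handled deterministically: the spike part [(1 - a(x)) x^2] of
    the risk at [ahat] is at most a constant plus a multiple of
    [ln (1 + k r_b(x))] with [b = 2 ahat], and since the [r_b(X_i)] sum to at
    most [n], concavity of [ln] bounds the sum over [s] coordinates by
    [s ln (n/s)].

    For the null coordinates take [T = sqrt (8 ln (n/s))] and
    [alpha = K (s/n) T]. Where [ahat <= alpha] the posterior weights are at most
    those at the fixed [alpha]; where [ahat > alpha], the constant 1 is at most
    [exp (l sum_i (r_alpha(X_i) - 1))], whose null factors have expectation
    below 1 because [E_0 r_alpha <= 1 - c/T]. So the risk is dominated by a sum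
    of products of functions of single coordinates; this also disposes of the
    possible non-measurability of [ahat], since integrals of nonnegative
    functions are monotone regardless. The second bound applies the first one
    at sparsity [max (s, c1 ln^2 n)]. *)

(** * Integrals on the line *)

Section Integrals.
Context {R : realType}.
Local Open Scope classical_set_scope.
Local Open Scope ring_scope.
Notation mu := (@lebesgue_measure R).
Implicit Types (f g : R -> R) (x m u : R).

Definition intble (f : R -> R) := mu.-integrable setT (EFin \o f).
Notation I f := (Rintegral mu setT f).

Lemma intble_meas f : intble f -> measurable_fun setT f.
Proof. by move=> /integrableP[/measurable_EFinP]. Qed.

Lemma EFin_I f : intble f -> (\int[mu]_x (f x)%:E)%E = (I f)%:E.
Proof. by move=> fi; rewrite fineK//; apply: integrable_fin_num. Qed.

Lemma intble_le f g : measurable_fun setT f -> (forall x, 0 <= f x <= g x) ->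
  intble g -> intble f.
Proof.
move=> mf fg; apply: le_integrable => //; first exact/measurable_EFinP.
move=> x _ /=; rewrite lee_fin; have /andP[f0 fgx] := fg x.
by rewrite !ger0_norm// (le_trans f0).
Qed.

Lemma intbleD f g : intble f -> intble g -> intble (fun x => f x + g x).
Proof. by move=> fi gi; apply: eq_integrable (integrableD _ fi gi). Qed.

Lemma intbleZ k f : intble f -> intble (fun x => k * f x).
Proof. by move=> fi; apply: eq_integrable (integrableZl _ k fi). Qed.

Lemma I_D f g : intble f -> intble g -> I (fun x => f x + g x) = I f + I g.
Proof. by move=> fi gi; rewrite RintegralD. Qed.

Lemma I_Z k f : intble f -> I (fun x => k * f x) = k * I f.
Proof. by move=> fi; rewrite RintegralZl. Qed.

Lemma I_le f g : intble f -> intble g -> (forall x, f x <= g x) -> I f <= I g.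
Proof. by move=> fi gi fg; apply: le_Rintegral => // x _. Qed.

Lemma I_ge0 f : (forall x, 0 <= f x) -> 0 <= I f.
Proof. by move=> f0; apply: Rintegral_ge0 => x _. Qed.

Lemma intbleT f (M : R) : measurable_fun setT f -> (forall x, 0 <= f x) ->
  (\int[mu]_x (f x)%:E <= M%:E)%E -> intble f.
Proof.
move=> mf f0 fM; apply/integrableP; split; first exact/measurable_EFinP.
under eq_integral do rewrite /= ger0_norm//.
exact: le_lt_trans fM (ltry _).
Qed.

(** * Gaussian and Cauchy densities *)

Lemma phi_ge0 x : 0 <= phi x :> R.
Proof. by rewrite /phi divr_ge0// expR_ge0. Qed.

Lemma phi_gt0 x : 0 < phi x :> R.
Proof. by rewrite /phi divr_gt0// ?expR_gt0// sqrtr_gt0 mulr_gt0// pi_gt0. Qed.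

Lemma phi_normal m (x : R) : phi (x - m) = normal_pdf m 1 x.
Proof.
rewrite normal_pdfE ?oner_eq0// /normal_peak /normal_fun /phi expr1n mulrC.
by rewrite mul1r mulr_natl.
Qed.

Lemma phiC (x u : R) : phi (x - u) = phi (u - x).
Proof. by rewrite /phi -sqrrN opprB. Qed.

Lemma intble_phi m : intble (fun x => phi (x - m)).
Proof.
apply: eq_integrable (integrable_normal_pdf m (1:R)) => // x _.
by rewrite /= phi_normal.
Qed.

Lemma I_phi m : I (fun x => phi (x - m)) = 1.
Proof.
rewrite /Rintegral; under eq_integral do rewrite phi_normal.
by rewrite integral_normal_pdf.
Qed.

Definition wide (m x : R) : R := expR (- (x - m) ^+ 2 / 4).
Definition Kwide : R := (normal_peak (Num.sqrt 2))^-1.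

Lemma Kwide_gt0 : 0 < Kwide.
Proof. by rewrite invr_gt0 normal_peak_gt0// sqrtr_eq0 -ltNge. Qed.

Lemma wide_normal m x : wide m x = Kwide * normal_pdf m (Num.sqrt 2) x.
Proof.
have s0 : Num.sqrt 2 != 0 :> R by rewrite sqrtr_eq0 -ltNge.
rewrite normal_pdfE// /Kwide mulKf ?gt_eqF ?normal_peak_gt0// /wide /normal_fun.
by congr (expR (_ / _)); rewrite sqr_sqrtr//; ring.
Qed.

Lemma intble_wide m : intble (wide m).
Proof.
apply: eq_integrable (intbleZ Kwide (integrable_normal_pdf m (Num.sqrt 2))) => // x _.
by rewrite /= wide_normal.
Qed.

Lemma I_wide m : I (wide m) = Kwide.
Proof.
rewrite (@eq_Rintegral _ _ _ mu setT (fun x => Kwide * normal_pdf m (Num.sqrt 2) x)); last first.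
  by move=> x _; exact: wide_normal.
rewrite I_Z; last exact: integrable_normal_pdf.
by rewrite /Rintegral integral_normal_pdf mulr1.
Qed.

Lemma gam_ge0 x : 0 <= gam x :> R.
Proof. by rewrite /gam divr_ge0// mulr_ge0 ?pi_ge0// addr_ge0// sqr_ge0. Qed.

Lemma gam_gt0 x : 0 < gam x :> R.
Proof. by rewrite /gam divr_gt0// mulr_gt0 ?pi_gt0// ltr_pwDl// sqr_ge0. Qed.

Lemma pi_ge1 : 1 <= pi :> R.
Proof. by have := @pi_ge2 R; lra. Qed.

Lemma gam_le1 x : gam x <= 1 :> R.
Proof.
rewrite /gam ler_pdivrMr ?mul1r; last by rewrite mulr_gt0 ?pi_gt0// ltr_pwDl// sqr_ge0.
have := pi_ge1; have := sqr_ge0 x; nra.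
Qed.

Lemma cont_gam : continuous (@gam R).
Proof.
move=> x; rewrite /gam; apply: cvgM; first exact: cvg_cst.
apply: cvgV; first by rewrite gt_eqF// mulr_gt0 ?pi_gt0// ltr_pwDl// sqr_ge0.
apply: cvgM; first exact: cvg_cst.
by apply: (@cvgD _ R^o); [exact: cvg_cst|exact: sqr_continuous].
Qed.

Lemma meas_gam : measurable_fun setT (@gam R).
Proof. exact: continuous_measurable_fun cont_gam. Qed.

Lemma integral_gam : (\int[mu]_x (gam x)%:E = 1)%E.
Proof.
rewrite ge0_symfun_integralT; [|exact: gam_ge0|exact: cont_gam|]; last first.
  by move=> x; rewrite /gam /= sqrrN.
rewrite -set_itvcy.
rewrite (@ge0_continuous_FTC2y _ _ (fun x => atan x / pi) 0 (2^-1)) //=.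
- by rewrite atan0 mul0r sube0 -EFinM divff.
- by move=> x _; exact: gam_ge0.
- by apply: continuous_subspaceT => x; exact: cont_gam.
- rewrite [X in _ --> X](_ : _ = pi / 2 * pi^-1); last first.
    by rewrite mulrAC divff ?gt_eqF ?pi_gt0// mul1r.
  by apply: cvgMl; exact: cvgy_atan.
- by apply: cvg_at_right_filter; apply: cvgMl => //; exact: continuous_atan.
- by move=> x _; rewrite derive1Mr// derive1_atan /gam div1r invfM mulrC.
Qed.
End Integrals.

(** * The slab marginal *)

Section Slab.
Context {R : realType}.
Local Open Scope classical_set_scope.
Local Open Scope ring_scope.
Notation mu := (@lebesgue_measure R).
Implicit Types (f g : R -> R) (x m u : R).
Notation I f := (Rintegral mu setT f).

(** Square [1 + y <= 8 (1 + y / 8) <= 8 exp (y / 8)]. *)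
Lemma expR_ge1Dx2 y : 0 <= y -> (1 + y) ^+ 2 <= 64 * expR (y / 4) :> R.
Proof.
move=> y0; have -> : y / 4 = y / 8 + y / 8 by lra.
rewrite expRD; have := expR_ge1Dx (y / 8); nra.
Qed.

Lemma sqrt2pi_ge1 : 1 <= Num.sqrt (2 * pi) :> R.
Proof.
by rewrite -{1}[1]sqrtr1 ler_wsqrtr// ; have := @pi_ge2 R; lra.
Qed.

(** Half of the Gaussian exponent absorbs the polynomial; the other half is [wide]. *)
Lemma phi_wide x u : (1 + (u - x) ^+ 2) ^+ 2 * phi (x - u) <= 64 * wide x u.
Proof.
rewrite phiC /phi /wide; set y := (u - x) ^+ 2.
have y0 : 0 <= y by exact: sqr_ge0.
have -> : - y / 2 = - y / 4 + - (y / 4) by lra.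
rewrite expRD expRN -(ler_pM2r (expR_gt0 (y / 4))).
have e1 := expR_ge1Dx2 y0; have e2 := sqrt2pi_ge1.
have e3 := expR_gt0 (- y / 4); have e4 := expR_gt0 (y / 4).
rewrite [leLHS](_ : _ = expR (- y / 4) * ((1 + y) ^+ 2 / Num.sqrt (2 * pi))); last first.
  by field; rewrite !gt_eqF//; lra.
rewrite [leRHS](_ : _ = expR (- y / 4) * (64 * expR (y / 4))); last by ring.
rewrite ler_pM2l//; apply: le_trans e1.
by rewrite ler_piMr ?sqr_ge0// invf_le1//; lra.
Qed.

(** Peetre's inequality. It moves the Cauchy weight between [u] and [x] at the price of one factor
    [1 + (u - x) ^+ 2], which yields both [gam_ub] and [gam_lb]. *)
Lemma peetre x u : 1 + x ^+ 2 <= 2 * (1 + u ^+ 2) * (1 + (u - x) ^+ 2).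
Proof. have := sqr_ge0 (u + (u - x)); have := sqr_ge0 (u * (u - x)); nra. Qed.

Lemma gamE u : gam u * (1 + u ^+ 2) = pi^-1 :> R.
Proof.
have := pi_gt0 R; have := sqr_ge0 u => *.
by rewrite /gam; field; rewrite !gt_eqF//; lra.
Qed.

Lemma gam_ub x u : gam u * (1 + x ^+ 2) <= 2 * (1 + (u - x) ^+ 2).
Proof.
have p1 : pi^-1 <= 1 :> R by rewrite invf_le1 ?pi_gt0// pi_ge1.
have := gamE u; have := peetre x u; have := gam_gt0 u; have := sqr_ge0 (u - x).
nra.
Qed.

Lemma gam_lb x u : (2 * pi * (1 + x ^+ 2))^-1 <= gam u * (1 + (u - x) ^+ 2).
Proof.
have pp := pi_gt0 R; have x0 := sqr_ge0 x.
rewrite -[leLHS]mul1r ler_pdivrMr; last by rewrite !mulr_gt0//; lra.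
have := peetre u x; rewrite -[(x - u) ^+ 2]sqrrN opprB.
have := gamE u; have := gam_gt0 u => g0 gE.
have e1 : 1 = pi * gam u * (1 + u ^+ 2) by rewrite -mulrA gE divff// gt_eqF.
have pg : 0 < pi * gam u by rewrite mulr_gt0.
by move=> h; rewrite {1}e1; apply: le_trans (ler_wpM2l (ltW pg) h) _; lra.
Qed.

Lemma cont_phi : continuous (@phi R).
Proof.
move=> x; rewrite (_ : @phi R = normal_pdf 0 1); first exact: continuous_normal_pdf.
by apply/funext => y; rewrite -phi_normal subr0.
Qed.

Lemma meas_phi : measurable_fun setT (@phi R).
Proof. exact: continuous_measurable_fun cont_phi. Qed.

Lemma meas_phi_sub x : measurable_fun setT (fun u => phi (x - u)).
Proof. by apply: measurableT_comp => //; [exact: meas_phi|exact: measurable_funB]. Qed.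

Lemma intble_phi_sub x : intble (fun u => phi (x - u)).
Proof. by under eq_fun do rewrite phiC; exact: intble_phi. Qed.

Lemma I_phi_sub x : I (fun u => phi (x - u)) = 1.
Proof. by under eq_fun do rewrite phiC; exact: I_phi. Qed.

Lemma meas_conv x : measurable_fun setT (fun u => phi (x - u) * gam u).
Proof. by apply: measurable_funM; [exact: meas_phi_sub|exact: meas_gam]. Qed.

Lemma intble_conv x : intble (fun u => phi (x - u) * gam u).
Proof.
apply: intble_le (meas_conv x) _ (intble_phi_sub x) => u.
by rewrite mulr_ge0 ?phi_ge0 ?gam_ge0//= ler_piMr ?phi_ge0// gam_le1.
Qed.

Lemma meas_conv2 x t : measurable_fun setT (fun u => (u - t) ^+ 2 * (phi (x - u) * gam u)).
Proof.
apply: measurable_funM (meas_conv x).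
by apply: measurable_funX; exact: measurable_funB.
Qed.

(** Moving the Cauchy weight to [x] costs one power of [1 + (u - x) ^+ 2] and the squared distance
    costs another; [phi_wide] absorbs both. *)
Lemma conv2_ub x u : (u - x) ^+ 2 * (phi (x - u) * gam u) * (1 + x ^+ 2) <= 128 * wide x u.
Proof.
have := gam_ub x u; have := phi_wide x u; have p0 := phi_ge0 (x - u).
have g0 := gam_ge0 u; set y := (u - x) ^+ 2; have y0 : 0 <= y by exact: sqr_ge0.
move=> h1 h2.
have : y * phi (x - u) * (gam u * (1 + x ^+ 2)) <= y * phi (x - u) * (2 * (1 + y)).
  by rewrite ler_wpM2l// mulr_ge0.
have : y * phi (x - u) * (2 * (1 + y)) <= 2 * ((1 + y) ^+ 2 * phi (x - u)).
  have : 0 <= (1 + y) * phi (x - u) by rewrite mulr_ge0//; lra.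
  nra.
nra.
Qed.

Lemma intble_conv2 x : intble (fun u => (u - x) ^+ 2 * (phi (x - u) * gam u)).
Proof.
apply: intble_le (meas_conv2 x x) _ (intbleZ 128 (intble_wide x)) => u.
have p0 : 0 <= (u - x) ^+ 2 * (phi (x - u) * gam u).
  by rewrite mulr_ge0 ?sqr_ge0// mulr_ge0 ?phi_ge0 ?gam_ge0.
rewrite p0 /=; apply: le_trans (conv2_ub x u).
by rewrite ler_peMr// lerDl sqr_ge0.
Qed.

Lemma I_conv2 x : I (fun u => (u - x) ^+ 2 * (phi (x - u) * gam u)) * (1 + x ^+ 2)
  <= 128 * Kwide.
Proof.
rewrite mulrC -I_Z; last exact: intble_conv2.
rewrite -(I_wide x) -I_Z; last exact: intble_wide.
apply: I_le => [||u]; [exact/intbleZ/intble_conv2|exact/intbleZ/intble_wide|].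
by rewrite mulrC conv2_ub.
Qed.

Lemma gconv_ub x : gconv x * (1 + x ^+ 2) <= 128 * Kwide.
Proof.
rewrite mulrC /gconv -I_Z; last exact: intble_conv.
rewrite -(I_wide x) -I_Z; last exact: intble_wide.
apply: I_le => [||u]; [exact/intbleZ/intble_conv|exact/intbleZ/intble_wide|].
have := gam_ub x u; have := phi_wide x u; have p0 := phi_ge0 (x - u).
have g0 := gam_ge0 u; set y := (u - x) ^+ 2; have y0 : 0 <= y by exact: sqr_ge0.
move=> h1 h2.
have : phi (x - u) * (gam u * (1 + x ^+ 2)) <= phi (x - u) * (2 * (1 + y)).
  by rewrite ler_wpM2l.
have : phi (x - u) * (2 * (1 + y)) <= 2 * ((1 + y) ^+ 2 * phi (x - u)).
  nra.
nra.
Qed.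

(** Together with [gconv_ub], the bound [gconv_lb] with this constant shows that the slab marginal
    decays exactly like [1 / (1 + x ^+ 2)]. *)
Definition cg : R := (2 * pi * (1 + 64 * Kwide))^-1.

Lemma cg_gt0 : 0 < cg.
Proof. by have := @Kwide_gt0 R; have := pi_gt0 R => *; rewrite invr_gt0 !mulr_gt0//; lra. Qed.

(* Jensen for y |-> 1/(1+y), through its tangent at the bound 64 Kwide on the
   second moment. *)
Lemma gconv_lb x : cg / (1 + x ^+ 2) <= gconv x.
Proof.
have K0 := @Kwide_gt0 R; have pp := pi_gt0 R; have x0 := sqr_ge0 x.
pose A := 1 + 64 * @Kwide R; have A0 : 0 < A by rewrite /A; lra.
set c0 := (2 * pi * (1 + x ^+ 2))^-1.
have c00 : 0 < c0 by rewrite invr_gt0 !mulr_gt0//; lra.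
(* The tangent bound [2 / A - (1 + y) / A ^+ 2] times [p], with [(1 + y) p] replaced by [64 w]; the
   last term is subtracted to make the integral exactly [c0 / A]. *)
have -> : cg / (1 + x ^+ 2) =
  I (fun u => c0 * (2 / A) * phi (x - u) + - (c0 * 64 / A ^+ 2) * wide x u
        + - (c0 / A ^+ 2) * phi (x - u)).
  have i1 := intble_phi_sub x; have i2 := intble_wide x.
  rewrite !I_D; try by repeat (try apply: intbleD; try exact: intbleZ).
  rewrite !I_Z// I_phi_sub I_wide /cg -/A /c0 /A.
  by field; rewrite !gt_eqF//; lra.
apply: I_le; [|exact: intble_conv|].
  by do 2 (try apply: intbleD); apply: intbleZ; [exact: intble_phi_sub|exact: intble_wide|exact: intble_phi_sub].
move=> u; have := gam_lb x u; have := phi_wide x u; have := phi_ge0 (x - u).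
rewrite -/c0; set y := (u - x) ^+ 2; set p := phi _; set w := wide _ _; set q := gam u.
move=> p0 h1 h2; have y0 : 0 <= y by exact: sqr_ge0.
have h3 : (1 + y) * p <= 64 * w by apply: le_trans h1; nra.
have h4 : c0 / (1 + y) <= q by rewrite ler_pdivrMr//; lra.
have h5 : 2 / A - (1 + y) / A ^+ 2 <= (1 + y)^-1.
  rewrite -subr_ge0 [leRHS](_ : _ = (A - (1 + y)) ^+ 2 / (A ^+ 2 * (1 + y))); last first.
    by field; rewrite !gt_eqF//; lra.
  by rewrite divr_ge0 ?sqr_ge0// mulr_ge0 ?sqr_ge0//; lra.
have h6 : p * (c0 * (2 / A - (1 + y) / A ^+ 2)) <= p * q.
  rewrite ler_wpM2l//; apply: le_trans h4; rewrite ler_pM2l//.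
apply: le_trans h6.
have a2 : 0 <= c0 / A ^+ 2 by rewrite divr_ge0// ?sqr_ge0// ltW.
have h7 : c0 / A ^+ 2 * ((1 + y) * p) <= c0 / A ^+ 2 * (64 * w) by rewrite ler_wpM2l.
have h8 : 0 <= c0 / A ^+ 2 * p by rewrite mulr_ge0.
rewrite -subr_ge0.
rewrite [leRHS](_ : _ = (c0 / A ^+ 2 * (64 * w) - c0 / A ^+ 2 * ((1 + y) * p)) + c0 / A ^+ 2 * p).
  lra.
by field; rewrite gt_eqF.
Qed.

Lemma gconv_gt0 x : 0 < gconv x.
Proof.
apply: lt_le_trans (gconv_lb x); rewrite divr_gt0 ?cg_gt0//.
by have := sqr_ge0 x; lra.
Qed.

Lemma EFin_gconv x : (gconv x)%:E = (\int[mu]_u (phi (x - u) * gam u)%:E)%E.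
Proof. by rewrite EFin_I//; exact: intble_conv. Qed.

Let meas_joint : measurable_fun setT (fun z : R * R => (phi (z.1 - z.2) * gam z.2)%:E).
Proof.
apply/measurable_EFinP; apply: measurable_funM.
  by apply: measurableT_comp; [exact: meas_phi|exact: measurable_funB].
by apply: measurableT_comp => //; exact: meas_gam.
Qed.

Lemma meas_gconv : measurable_fun setT (@gconv R).
Proof.
apply/measurable_EFinP.
rewrite (_ : _ \o _ = fun x => (\int[mu]_u (phi (x - u) * gam u)%:E)%E); last first.
  by apply/funext => x /=; exact: EFin_gconv.
apply: (@measurable_fun_fubini_tonelli_F _ _ _ _ _ mu (fun z : R * R => (phi (z.1 - z.2) * gam z.2)%:E)) => //.
by move=> z; rewrite lee_fin mulr_ge0 ?phi_ge0 ?gam_ge0.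
Qed.

(** Tonelli: the convolution of two probability densities is one. *)
Lemma integral_gconv : (\int[mu]_x (gconv x)%:E = 1)%E.
Proof.
under eq_integral do rewrite EFin_gconv.
rewrite (@fubini_tonelli _ _ _ _ _ mu mu (fun z : R * R => (phi (z.1 - z.2) * gam z.2)%:E))//=; last first.
  by move=> z; rewrite lee_fin mulr_ge0 ?phi_ge0 ?gam_ge0.
rewrite -(integral_gam (R := R)); apply: eq_integral => u _.
under eq_integral do rewrite mulrC.
by rewrite EFin_I ?I_Z ?I_phi ?mulr1//; [exact: intble_phi|exact/intbleZ/intble_phi].
Qed.

Lemma intble_gconv : intble (@gconv R).
Proof.
apply: (@intbleT _ _ 1) meas_gconv _ _; last by rewrite integral_gconv.
by move=> x; rewrite ltW// gconv_gt0.
Qed.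

Lemma I_gconv : I (@gconv R) = 1.
Proof. by rewrite /Rintegral integral_gconv. Qed.

End Slab.

(** * The posterior at a fixed weight *)

Section Posterior.
Context {R : realType}.
Local Open Scope classical_set_scope.
Local Open Scope ring_scope.
Notation mu := (@lebesgue_measure R).
Implicit Types (f g : R -> R) (x m u alpha a b t : R).
Notation I f := (Rintegral mu setT f).

(** [marg] and [slab_ratio] are [q_a] and [r_a] of the header. *)
Definition marg alpha x : R := (1 - alpha) * phi x + alpha * gconv x.

Definition slab_ratio alpha x : R := gconv x / marg alpha x.

Lemma marg_gt0 alpha x : 0 <= alpha <= 1 -> 0 < marg alpha x.
Proof. by move=> /andP[a0 a1]; rewrite /marg; have := phi_gt0 x; have := gconv_gt0 x; nra. Qed.

Lemma apostE alpha x : apost alpha x = alpha * slab_ratio alpha x.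
Proof. by rewrite /apost /slab_ratio mulrA. Qed.

Lemma apost_ge0 alpha x : 0 <= alpha <= 1 -> 0 <= apost alpha x.
Proof.
move=> aI; have /andP[a0 _] := aI.
by rewrite apostE mulr_ge0// divr_ge0// ltW// ?marg_gt0// gconv_gt0.
Qed.

Lemma apostC alpha x : 0 <= alpha <= 1 ->
  1 - apost alpha x = (1 - alpha) * phi x / marg alpha x.
Proof.
move=> aI; have m0 := marg_gt0 x aI.
by rewrite apostE /slab_ratio; move: m0; rewrite /marg => m0; field; rewrite gt_eqF.
Qed.

Lemma apost_le1 alpha x : 0 <= alpha <= 1 -> apost alpha x <= 1.
Proof.
move=> aI; have /andP[_ a1] := aI; rewrite -subr_ge0 apostC//.
by rewrite divr_ge0 ?(ltW (marg_gt0 _ aI))// mulr_ge0 ?phi_ge0//; lra.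
Qed.

Lemma apost_mono a b x : 0 <= a -> a <= b -> b <= 1 -> apost a x <= apost b x.
Proof.
move=> a0 ab b1; have aI : 0 <= a <= 1 by rewrite a0 (le_trans ab).
have bI : 0 <= b <= 1 by rewrite b1 (le_trans a0).
rewrite /apost -!/(marg _ _) ler_pdivrMr ?marg_gt0// mulrAC ler_pdivlMr ?marg_gt0//.
have p0 := phi_gt0 x; have g0 := gconv_gt0 x; rewrite /marg -subr_ge0.
rewrite [leRHS](_ : _ = (b - a) * (gconv x * phi x)); last by ring.
by rewrite mulr_ge0 ?subr_ge0// mulr_ge0// ltW.
Qed.

(* Bounds the second moment of the slab posterior about the observation. *)
Definition Cm : R := 128 * Kwide / cg.

Lemma Cm_gt0 : 0 < Cm.
Proof. by rewrite divr_gt0 ?cg_gt0// mulr_gt0// Kwide_gt0. Qed.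

Lemma Kwide_le_gconv x : 128 * Kwide <= Cm * gconv x * (1 + x ^+ 2).
Proof.
have x0 := sqr_ge0 x; have c0 := @cg_gt0 R; have := gconv_lb x; have := @Kwide_gt0 R.
rewrite ler_pdivrMr; last lra.
move=> K0 h; rewrite /Cm -mulrA -[leLHS](divfK (lt0r_neq0 c0)).
by rewrite ler_wpM2l// divr_ge0// ltW// mulr_gt0.
Qed.

Lemma intble_gamx x : intble (gamx x).
Proof.
rewrite (_ : gamx x = fun u => (gconv x)^-1 * (phi (x - u) * gam u)).
  exact/intbleZ/intble_conv.
by apply/funext => u; rewrite /gamx mulrC.
Qed.

Lemma I_gamx x : I (gamx x) = 1.
Proof.
rewrite (_ : gamx x = fun u => (gconv x)^-1 * (phi (x - u) * gam u)).
  by rewrite I_Z ?mulVf ?gt_eqF ?gconv_gt0//; exact: intble_conv.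
by apply/funext => u; rewrite /gamx mulrC.
Qed.

Lemma gamx_ge0 x u : 0 <= gamx x u.
Proof. by rewrite divr_ge0 ?(ltW (gconv_gt0 _))// mulr_ge0 ?phi_ge0 ?gam_ge0. Qed.

(** Split [u - t] at [x]. The slab posterior has bounded second moment about [x] because the
    integral in [I_conv2] and the normalisation [gconv x] are of the same order
    [1 / (1 + x ^+ 2)]. *)
Lemma integral_gamx_sq_ub x t :
  (\int[mu]_u ((u - t) ^+ 2 * gamx x u)%:E <= (2 * Cm + 2 * (x - t) ^+ 2)%:E)%E.
Proof.
have g0 := gconv_gt0 x; have ig := intble_gamx x; have i2 := intble_conv2 x.
pose h u := 2 / gconv x * ((u - x) ^+ 2 * (phi (x - u) * gam u)) +
         2 * (x - t) ^+ 2 * gamx x u.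
have ih : intble h by apply: intbleD; exact: intbleZ.
have Ih : I h <= 2 * Cm + 2 * (x - t) ^+ 2.
  rewrite I_D ?I_Z ?I_gamx ?mulr1//; try exact: intbleZ.
  rewrite lerD2r -mulrA ler_pM2l// mulrC ler_pdivrMr//.
  have := I_conv2 x; have := Kwide_le_gconv x; have x0 := sqr_ge0 x => h1 h2.
  by rewrite -(@ler_pM2r _ (1 + x ^+ 2)); lra.
apply: (@le_trans _ _ (I h)%:E); last by rewrite lee_fin.
rewrite -EFin_I//; apply: ge0_le_integral => //.
- by move=> u _; rewrite lee_fin mulr_ge0 ?sqr_ge0 ?gamx_ge0.
- apply/measurable_EFinP; apply: measurable_funM; last exact: intble_meas.
  by apply: measurable_funX; exact: measurable_funB.
- by apply/measurable_EFinP; exact: intble_meas.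
- move=> u _; rewrite lee_fin /h.
  have -> : 2 / gconv x * ((u - x) ^+ 2 * (phi (x - u) * gam u)) =
    2 * (u - x) ^+ 2 * gamx x u.
    by rewrite /gamx; field; rewrite gt_eqF.
  rewrite -mulrDl ler_wpM2r ?gamx_ge0//.
  by have := sqr_ge0 ((u - x) - (x - t)); nra.
Qed.

Lemma post_sq_ge0 alpha x t : 0 <= alpha <= 1 -> (0 <= post_sq alpha x t)%E.
Proof.
move=> aI; rewrite /post_sq adde_ge0//.
  by rewrite lee_fin mulr_ge0 ?sqr_ge0// subr_ge0 apost_le1.
rewrite mule_ge0 ?lee_fin ?apost_ge0//; apply: integral_ge0 => u _.
by rewrite lee_fin mulr_ge0 ?sqr_ge0 ?gamx_ge0.
Qed.

Lemma post_sq_ub alpha x t : 0 <= alpha <= 1 ->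
  (post_sq alpha x t <= ((1 - apost alpha x) * t ^+ 2 +
      apost alpha x * (2 * Cm + 2 * (x - t) ^+ 2))%:E)%E.
Proof.
move=> aI; rewrite /post_sq EFinD leeD2l// [leRHS]EFinM.
by rewrite lee_wpmul2l ?lee_fin ?apost_ge0//; exact: integral_gamx_sq_ub.
Qed.

(** The unknown mean is traded for the observation, so that the only term depending on the weight,
    [(1 - a(x)) x^2], can be bounded deterministically; the noise [x - t] is left to the
    expectation. *)
Lemma post_sq_signal alpha x t : 0 <= alpha <= 1 ->
  (post_sq alpha x t <=
    (2 * ((1 - apost alpha x) * x ^+ 2) + 2 * (x - t) ^+ 2 + 2 * Cm)%:E)%E.
Proof.
move=> aI; apply: le_trans (post_sq_ub _ _ aI) _; rewrite lee_fin.
have := apost_ge0 x aI; have := apost_le1 x aI; set p := apost _ _ => p1 p0.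
have t2 : t ^+ 2 <= 2 * x ^+ 2 + 2 * (x - t) ^+ 2 by have := sqr_ge0 (2 * x - t); nra.
have : (1 - p) * t ^+ 2 <= (1 - p) * (2 * x ^+ 2 + 2 * (x - t) ^+ 2).
  by rewrite ler_wpM2l//; lra.
have := Cm_gt0; nra.
Qed.

(** For a zero mean the whole risk is carried by the slab, so the bound is proportional to the slab
    weight and hence monotone in [alpha]. *)
Lemma post_sq_null alpha x : 0 <= alpha <= 1 ->
  (post_sq alpha x 0 <= ((2 * Cm + 2) * (apost alpha x * (1 + x ^+ 2)))%:E)%E.
Proof.
move=> aI; apply: le_trans (post_sq_ub _ _ aI) _; rewrite lee_fin.
rewrite subr0 expr0n mulr0 add0r [leRHS]mulrCA ler_wpM2l ?apost_ge0//.
by have := sqr_ge0 x; have := Cm_gt0; nra.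
Qed.

(** * The posterior median threshold *)

Lemma threshold_gt0 alpha t : is_threshold alpha t -> alpha != 0.
Proof.
(* At weight 0 the posterior is the point mass at 0, whose median is 0 even at the observation
   [t + 1]. *)
move=> [t0 H]; apply/eqP => a0; have /H : postmed_zero alpha (t + 1).
  by rewrite /postmed_zero /apost a0 !mul0r !mul0e !lee_fin invr_ge0.
by rewrite gtr0_norm; lra.
Qed.

(* The slab posterior puts mass at least 1 - phi(t)/g(t) on (0, oo), so the
   median can vanish at t only if the spike keeps a fixed share of the mass. *)
Lemma threshold_ub alpha t : 0 <= alpha <= 1 -> is_threshold alpha t ->
  alpha * gconv t <= 2 * phi t.
Proof.
move=> aI [t0 H]; have g0 := gconv_gt0 t; have p0 := phi_gt0 t.
have /H[_] : `|t| <= t by rewrite gtr0_norm.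
pose h u := if 0 < u then gamx t u else 0.
have mD : measurable [set u : R | 0 < u] by rewrite -set_itvoy.
have hE : EFin \o h = (EFin \o gamx t) \_ [set u : R | 0 < u].
  apply/funext => u; rewrite patchE /h /=; case: ltP => u0.
    by rewrite mem_set.
  by rewrite memNset//=; apply/negP; rewrite -leNgt.
have mh : measurable_fun setT h.
  apply/measurable_EFinP; rewrite hE; apply: (iffLR (measurable_restrictT _ mD)).
  apply/measurable_EFinP/measurable_funTS.
  exact: (intble_meas (intble_gamx t)).
have ih : intble h.
  apply: intble_le mh _ (intble_gamx t) => u; rewrite /h.
  by case: ifP; rewrite ?gamx_ge0 ?lexx.
rewrite integral_mkcond -hE EFin_I// -EFinM lee_fin => aIh.
(* For [u <= 0] one has [phi (t - u) <= phi t], and [gam] integrates to 1, so the half line [u <= 0]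
   has slab posterior mass at most [phi t / gconv t]. *)
have Ih : 1 - phi t / gconv t <= I h.
  rewrite lerBlDr -(I_gamx t) -[phi t / _]mulr1.
  have <- : I (@gam R) = 1 by rewrite /Rintegral integral_gam.
  have igam : intble (@gam R).
    by apply: (@intbleT _ _ 1) meas_gam _ _; [exact: gam_ge0|rewrite integral_gam].
  rewrite -I_Z// -I_D//; last exact: intbleZ.
  apply: I_le => [||u]; [exact: intble_gamx|by apply: intbleD => //; exact: intbleZ|].
  rewrite /h; case: ltP => u0.
    by rewrite lerDl mulr_ge0 ?gam_ge0// divr_ge0// ltW.
  rewrite add0r /gamx mulrAC ler_wpM2r ?gam_ge0// ler_wpM2r ?invr_ge0 ?(ltW g0)//.
  rewrite /phi ler_wpM2r ?invr_ge0// ler_expR; nra.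
have : apost alpha t * (1 - phi t / gconv t) <= 2^-1.
  by apply: le_trans aIh; rewrite ler_wpM2l// apost_ge0.
have m0 := marg_gt0 t aI.
rewrite apostE /slab_ratio (_ : _ * _ = alpha * (gconv t - phi t) / marg alpha t); last first.
  by field; rewrite !gt_eqF.
(* Clearing the denominator gives [alpha * g <= (1 + alpha) * phi]. *)
rewrite ler_pdivrMr// /marg; move/andP: aI => [a0 a1]; nra.
Qed.

End Posterior.

(** * Likelihood comparison and signals *)

Section Signals.
Context {R : realType}.
Implicit Types (x alpha a b : R) (n s : nat) (X : nat -> R).

Lemma ln_leB1 x : 0 < x -> ln x <= x - 1.
Proof. by move=> x0; have := expR_ge1Dx (ln x); rewrite lnK ?posrE//; lra. Qed.

(** Concavity of the log-likelihood in the weight: its increment from [a] to [b] lies below the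
    tangent at [a], by [ln y <= y - 1] applied to the ratio of the marginals. *)
Lemma loglik_leP n a b X : 0 <= a <= 1 -> 0 <= b <= 1 ->
  loglik n a X <= loglik n b X ->
  0 <= (b - a) * \sum_(i < n) (gconv (X i) - phi (X i)) / marg a (X i).
Proof.
move=> aI bI; rewrite -subr_ge0 -sumrB => h; apply: le_trans h _.
rewrite mulr_sumr; apply: ler_sum => i _.
rewrite -!/(marg _ _); set x := X i.
have ma := marg_gt0 x aI; have mb := marg_gt0 x bI.
rewrite -ln_div ?posrE//; apply: le_trans (ln_leB1 _) _; first exact: divr_gt0.
rewrite le_eqVlt; apply/orP; left; apply/eqP.
by move: ma; rewrite /marg => ma; field; rewrite gt_eqF.
Qed.

(** Since [1 - a >= 0], the sign of the score at [a] passes to the sum of the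
    [slab_ratio a (X i) - 1]. *)
Lemma slab_ratioB1 a x : 0 <= a <= 1 ->
  slab_ratio a x - 1 = (1 - a) * ((gconv x - phi x) / marg a x).
Proof.
move=> aI; have := marg_gt0 x aI; rewrite /slab_ratio /marg => m0.
by field; rewrite gt_eqF.
Qed.

Lemma sum_slab_ratioB n a X : 0 <= a <= 1 ->
  \sum_(i < n) slab_ratio a (X i) - n%:R =
  (1 - a) * \sum_(i < n) (gconv (X i) - phi (X i)) / marg a (X i).
Proof.
move=> aI; rewrite mulr_sumr (_ : n%:R = \sum_(i < n) 1); last first.
  by rewrite sumr_const card_ord.
by rewrite -sumrB; apply: eq_bigr => i _; rewrite slab_ratioB1.
Qed.

Lemma score_ge n a b X : 0 <= a -> a < b -> b <= 1 ->
  loglik n a X <= loglik n b X -> n%:R <= \sum_(i < n) slab_ratio a (X i).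
Proof.
move=> a0 ab b1 h; have aI : 0 <= a <= 1 by rewrite a0 /=; lra.
rewrite -subr_ge0 sum_slab_ratioB//.
have bI : 0 <= b <= 1 by rewrite b1 andbT; lra.
have := loglik_leP aI bI h; rewrite pmulr_rge0 ?subr_gt0// => h2.
by rewrite mulr_ge0//; lra.
Qed.

Lemma score_le n a b X : 0 <= a -> a < b -> b <= 1 ->
  loglik n b X <= loglik n a X -> \sum_(i < n) slab_ratio b (X i) <= n%:R.
Proof.
move=> a0 ab b1 h; have aI : 0 <= a <= 1 by rewrite a0 /=; lra.
rewrite -subr_le0 sum_slab_ratioB//; last by rewrite b1 andbT; lra.
have bI : 0 <= b <= 1 by rewrite b1 andbT; lra.
have := loglik_leP bI aI h; rewrite nmulr_rge0 ?subr_lt0// => h2.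
by rewrite mulr_ge0_le0//; lra.
Qed.

(** * The spike part of the risk at a signal *)

Definition cw : R := cg / 4.

Lemma cw_gt0 : 0 < cw. Proof. by rewrite divr_gt0// cg_gt0. Qed.

Lemma cw_le1 : cw <= 1.
Proof.
have K0 := @Kwide_gt0 R; have p1 := @pi_ge1 R.
have : @cg R <= 1 by rewrite /cg invf_le1; nra.
by rewrite /cw; lra.
Qed.

(** The slab marginal has polynomial tails, so half of the Gaussian exponent can be given back:
    [1 + x^2 <= 4 exp (x^2 / 4)], whence the 4 in [cw]. *)
Lemma slab_lb x : cw * expR (x ^+ 2 / 4) * phi x <= gconv x.
Proof.
apply: le_trans (gconv_lb x); have x0 := sqr_ge0 x; have c0 := @cg_gt0 R.
rewrite /phi /cw; set y := x ^+ 2 in x0 *.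
have -> : - y / 2 = - (y / 4) - y / 4 by lra.
rewrite expRD.
have -> : cg / 4 * expR (y / 4) * (expR (- (y / 4)) * expR (- (y / 4)) / Num.sqrt (2 * pi)) =
  cg * ((expR (y / 4) * 4)^-1 * (expR (y / 4) * expR (- (y / 4))) / Num.sqrt (2 * pi)).
  have := expR_gt0 (y / 4); have := @sqrt2pi_ge1 R => ? ?.
  by rewrite expRN; field; rewrite !gt_eqF//; lra.
rewrite expRN divff ?gt_eqF ?expR_gt0// mulr1 ler_pM2l//.
have := expR_ge1Dx (y / 4) => e1.
rewrite ler_pdivrMr; last by have := @sqrt2pi_ge1 R; lra.
apply: (@le_trans _ _ ((1 + y)^-1)).
  by rewrite lef_pV2 ?posrE; lra.
by rewrite ler_peMr ?sqrt2pi_ge1// invr_ge0; lra.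
Qed.

Lemma sqr_expN x c : 0 < c -> x ^+ 2 * expR (- (x ^+ 2 / c)) <= c.
Proof.
move=> c0; rewrite expRN ler_pdivrMr ?expR_gt0//.
have := expR_ge1Dx (x ^+ 2 / c); rewrite -(ler_pM2l c0) => h.
apply: le_trans h; rewrite [leRHS](_ : _ = c + x ^+ 2); first lra.
by field; rewrite gt_eqF.
Qed.

(** Keep only the slab term of the denominator and apply [slab_lb]. *)
Lemma apostC_le alpha x : 0 < alpha -> alpha <= 1 ->
  1 - apost alpha x <= alpha^-1 * (expR (- (x ^+ 2 / 4)) / cw).
Proof.
move=> a0 a1; have aI : 0 <= alpha <= 1 by rewrite (ltW a0).
have g0 := gconv_gt0 x; have p0 := phi_gt0 x; have c0 := cw_gt0.
rewrite apostC// ler_pdivrMr ?marg_gt0//.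
have := slab_lb x; set E := expR (x ^+ 2 / 4) => h.
have E0 : 0 < E by exact: expR_gt0.
rewrite expRN -/E; have : alpha^-1 * (E^-1 / cw) * (alpha * (cw * E * phi x)) <=
  alpha^-1 * (E^-1 / cw) * marg alpha x.
  rewrite ler_wpM2l//; first by rewrite ltW// mulr_gt0 ?invr_gt0// divr_gt0 ?invr_gt0.
  have h1 : alpha * (cw * E * phi x) <= alpha * gconv x by rewrite ler_pM2l.
  have h2 : 0 <= (1 - alpha) * phi x by rewrite mulr_ge0 ?(ltW p0)//; lra.
  by rewrite /marg; lra.
apply: le_trans; rewrite [leRHS](_ : _ = phi x); first nra.
by field; rewrite !gt_eqF.
Qed.

(** In each case of [signal_small_alpha], [marg (2 * alpha) x] is at most 3 times the larger of
    [phi x] and [alpha * gconv x]; dividing by [cw] absorbs the constant of [slab_lb]. *)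
Definition kap : R := 3 / cw.

Lemma slab_ratio_ge0 a x : 0 <= a <= 1 -> 0 <= slab_ratio a x.
Proof. by move=> aI; rewrite divr_ge0// ltW ?marg_gt0// gconv_gt0. Qed.

Lemma kap_ge1 : 1 <= kap.
Proof. by rewrite /kap ler_pdivlMr ?cw_gt0//; have := cw_le1; lra. Qed.

(** The range of [alpha] in which [2 * alpha] need not be a weight below 1. Here the spike weight
    alone is small enough, of order [exp (- x^2 / 4)]. *)
Lemma signal_large_alpha alpha x : 1 / 2 <= alpha -> alpha <= 1 ->
  (1 - apost alpha x) * x ^+ 2 <= 8 / cw.
Proof.
move=> a0 a1; have ap : 0 < alpha by lra.
have h1 := apostC_le x ap a1.
have h2 : (1 - apost alpha x) * x ^+ 2 <= alpha^-1 * (expR (- (x ^+ 2 / 4)) / cw) * x ^+ 2.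
  by rewrite ler_wpM2r ?sqr_ge0.
apply: le_trans h2 _.
have h3 : alpha^-1 <= 2 by rewrite invf_ple ?posrE//; lra.
have h4 := @sqr_expN x 4 ltac:(lra).
rewrite (_ : _ * _ = alpha^-1 * (x ^+ 2 * expR (- (x ^+ 2 / 4))) / cw); last by ring.
rewrite ler_pM2r ?invr_gt0 ?cw_gt0//.
have e0 := expR_ge0 (- (x ^+ 2 / 4)); have x0 := sqr_ge0 x.
set z := _ * expR _ in h4 *.
have z0 : 0 <= z by rewrite mulr_ge0.
have : 0 < alpha^-1 by rewrite invr_gt0.
nra.
Qed.

(* If alpha g <= phi then 1 + kap r already exceeds exp (x^2/4). Otherwise
   r >= 1/(3 alpha), which controls x^2 up to 8 ln (1/alpha), and beyond that the
   spike weight is exponentially small. *)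
Lemma signal_small_alpha alpha x : 0 < alpha -> alpha < 1 / 2 ->
  (1 - apost alpha x) * x ^+ 2 <=
  8 / cw + 8 * ln (1 + kap * slab_ratio (2 * alpha) x).
Proof.
move=> a0 a1; have aI : 0 <= alpha <= 1 by apply/andP; split; lra.
have bI : 0 <= 2 * alpha <= 1 by apply/andP; split; lra.
have c0 := cw_gt0; have r0 := slab_ratio_ge0 x bI; have k1 := kap_ge1.
set r := slab_ratio _ _ in r0 *.
have g0 := gconv_gt0 x; have p0 := phi_gt0 x; have x0 := sqr_ge0 x.
have p1 := apost_le1 x aI; have pp := apost_ge0 x aI.
have mb := marg_gt0 x bI.
have kr : kap * r <= 1 + kap * r by lra.
have c8 : 0 <= 8 / cw by rewrite divr_ge0// ltW.
have l0 : 0 <= ln (1 + kap * r) by rewrite ln_ge0//; nra.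
have xle : (1 - apost alpha x) * x ^+ 2 <= x ^+ 2 by nra.
have key y : expR y <= kap * r -> y <= ln (1 + kap * r).
  move=> h; rewrite -(expRK y) ler_ln ?posrE ?expR_gt0//; nra.
have [h|h] := leP (alpha * gconv x) (phi x).
  have : x ^+ 2 / 4 <= ln (1 + kap * r).
    apply: key; rewrite /r /slab_ratio /kap mulrA ler_pdivlMr//.
    rewrite [leRHS]mulrAC ler_pdivlMr//.
    have := slab_lb x; set E := expR _ => h2; have E0 : 0 < E by exact: expR_gt0.
    have : marg (2 * alpha) x <= 3 * phi x by rewrite /marg; nra.
    by move=> h3; have : cw * E * marg (2 * alpha) x <= cw * E * (3 * phi x);
      [rewrite ler_pM2l// mulr_gt0|nra].
  nra.
have [h1|h1] := leP (x ^+ 2) (8 * ln (alpha^-1)).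
  have : ln alpha^-1 <= ln (1 + kap * r).
    apply: key; rewrite lnK ?posrE ?invr_gt0// /r /slab_ratio mulrA ler_pdivlMr//.
    rewrite mulrC ler_pdivrMr//.
    have h3 : marg (2 * alpha) x <= 3 * alpha * gconv x by rewrite /marg; nra.
    have k3 : 3 <= kap by rewrite /kap ler_peMr// invf_ge1 ?cw_le1.
    by apply: le_trans h3 _; rewrite mulrAC ler_pM2r// ler_pM2r.
  nra.
have h2 := apostC_le x a0 (ltac:(lra) : alpha <= 1).
have h3 : alpha^-1 <= expR (x ^+ 2 / 8).
  rewrite -[leLHS]lnK ?posrE ?invr_gt0// ler_expR; lra.
have h4 := @sqr_expN x 8 ltac:(lra).
have h5 : alpha^-1 * (expR (- (x ^+ 2 / 4)) / cw) <= expR (- (x ^+ 2 / 8)) / cw.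
  rewrite mulrA ler_pM2r ?invr_gt0//.
  have -> : - (x ^+ 2 / 8) = x ^+ 2 / 8 + - (x ^+ 2 / 4) by lra.
  by rewrite expRD ler_pM2r ?expR_gt0.
have h6 : (1 - apost alpha x) * x ^+ 2 <= expR (- (x ^+ 2 / 8)) / cw * x ^+ 2.
  by rewrite ler_wpM2r// (le_trans h2).
have h7 : expR (- (x ^+ 2 / 8)) / cw * x ^+ 2 <= 8 / cw.
  by rewrite mulrAC ler_pM2r ?invr_gt0// mulrC.
lra.
Qed.

Lemma ln_tangent z y : 0 < z -> 0 < y -> ln y <= ln z + y / z - 1 :> R.
Proof.
move=> z0 y0; have := ln_leB1 (divr_gt0 y0 z0).
by rewrite ln_div ?posrE//; lra.
Qed.

Lemma signals_sum n s alpha X (P : pred 'I_n) :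
  (0 < s)%N -> (s <= n)%N -> (#|P| <= s)%N -> 0 < alpha -> alpha <= 1 ->
  (alpha < 1 / 2 -> \sum_(i < n) slab_ratio (2 * alpha) (X i) <= n%:R) ->
  \sum_(i < n | P i) (1 - apost alpha (X i)) * X i ^+ 2 <=
  s%:R * (8 / cw + 8 + 8 * kap + 8 * ln (n%:R / s%:R)).
Proof.
move=> s0 sn Ps a0 a1 H.
have c8 : 0 <= 8 / cw by rewrite divr_ge0// ltW// cw_gt0.
have k1 := kap_ge1.
have sR : 0 < s%:R :> R by rewrite ltr0n.
have snR : s%:R <= n%:R :> R by rewrite ler_nat.
have z0 : 1 <= n%:R / s%:R :> R by rewrite ler_pdivlMr// mul1r.
have l0 := ln_ge0 z0.
have cst (c : R) : 0 <= c -> \sum_(i < n | P i) c <= s%:R * c.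
  by move=> c0; rewrite (sumr_const P) -[leLHS]mulr_natl ler_wpM2r// ler_nat.
have [h|h] := ltP alpha (1 / 2); last first.
  apply: (@le_trans _ _ (\sum_(i < n | P i) 8 / cw)).
    by apply: ler_sum => i _; exact: signal_large_alpha.
  by apply: (le_trans (cst _ c8)); rewrite ler_pM2l//; lra.
have bI : 0 <= 2 * alpha <= 1 by apply/andP; split; lra.
set z := n%:R / s%:R in z0 l0 *.
(* Jensen for [ln] through its tangent at [z = n / s]: the linear terms add up to at most
   [s + kap n] by the score bound, and dividing by [z] makes this of order [s]. *)
apply: (@le_trans _ _ (\sum_(i < n | P i) (8 / cw + 8 * ln z) +
   8 * (\sum_(i < n | P i) (1 + kap * slab_ratio (2 * alpha) (X i)) / z))).
  rewrite mulr_sumr -big_split /=; apply: ler_sum => i _.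
  have r0 := slab_ratio_ge0 (X i) bI.
  have := signal_small_alpha (X i) a0 h.
  have y0 : 0 < 1 + kap * slab_ratio (2 * alpha) (X i) by nra.
  have := ln_tangent (ltac:(lra) : 0 < z) y0; lra.
have e1 : \sum_(i < n | P i) (1 + kap * slab_ratio (2 * alpha) (X i)) <= s%:R + kap * n%:R.
  rewrite big_split /= lerD//; first by rewrite -[leRHS]mulr1 cst.
  rewrite -mulr_sumr ler_wpM2l//; first lra.
  apply: le_trans (H h); rewrite [leRHS](bigID P) /= lerDl.
  by apply: sumr_ge0 => i _; exact: slab_ratio_ge0.
rewrite -mulr_suml.
have e2 : (\sum_(i < n | P i) (1 + kap * slab_ratio (2 * alpha) (X i))) / z <= s%:R + kap * s%:R.
  rewrite ler_pdivrMr; last lra.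
  have zs : s%:R * z = n%:R by rewrite /z mulrC divfK ?gt_eqF.
  rewrite -zs in e1 *; have : s%:R <= s%:R * z by rewrite ler_peMr// ltW.
  by lra.
have := cst (8 / cw + 8 * ln z) ltac:(lra).
nra.
Qed.

End Signals.

(** * Null moments *)

Section NullMoments.
Context {R : realType}.
Local Open Scope classical_set_scope.
Local Open Scope ring_scope.
Notation mu := (@lebesgue_measure R).
Implicit Types (x a b alpha T : R).
Notation I f := (Rintegral mu setT f).

Lemma integral_indic_itv a b : a <= b ->
  (\int[mu]_x (\1_(`[a, b] : set R) x)%:E = (b - a)%:E)%E.
Proof.
move=> ab; rewrite integral_indic//= setIT lebesgue_measure_itv/= lte_fin.
case: ltP => // ba; have -> : a = b by apply/eqP; rewrite eq_le ab.
by rewrite subrr.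
Qed.

Lemma intble_indic a b : a <= b -> intble (\1_(`[a, b] : set R)).
Proof.
move=> ab; apply: (@intbleT _ _ (b - a)) => //.
by rewrite integral_indic_itv.
Qed.

Lemma I_indic a b : a <= b -> I (\1_(`[a, b] : set R)) = b - a.
Proof. by move=> ab; rewrite /Rintegral integral_indic_itv. Qed.

Lemma meas_slab_ratio alpha : 0 <= alpha <= 1 -> measurable_fun setT (slab_ratio alpha).
Proof.
move=> aI.
have mm : measurable_fun setT (marg alpha).
  by apply: measurable_funD; apply: measurable_funM => //; [exact: meas_phi|exact: meas_gconv].
apply: measurable_funM; first exact: meas_gconv.
apply: (measurable_comp (F := [set x : R | x != 0])) => //.
- apply: open_measurable; exact: open_neq.
- by move=> y [x _ <-] /=; rewrite gt_eqF// marg_gt0.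
- apply: open_continuous_measurable_fun; first exact: open_neq.
  by move=> y; rewrite inE /= => y0; exact: inv_continuous.
Qed.

Lemma meas_apost alpha : 0 <= alpha <= 1 -> measurable_fun setT (apost alpha).
Proof.
move=> aI; rewrite (_ : apost alpha = fun x => alpha * slab_ratio alpha x).
  by apply: measurable_funM => //; exact: meas_slab_ratio.
by apply/funext => x; rewrite apostE.
Qed.

(** Rests on [(1 + 2 a) (1 - a) >= 1] for [a <= 1 / 2]. *)
Lemma phi_marg alpha x : 0 <= alpha -> alpha <= 1 / 2 ->
  phi x / marg alpha x <= 1 + 2 * alpha.
Proof.
move=> a0 a1; have aI : 0 <= alpha <= 1 by apply/andP; split; lra.
have g0 := gconv_gt0 x; have p0 := phi_gt0 x.
have h1 : 0 <= alpha * (1 - 2 * alpha) * phi x by rewrite !mulr_ge0 ?(ltW p0)//; lra.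
have h2 : 0 <= (1 + 2 * alpha) * alpha * gconv x by rewrite !mulr_ge0 ?(ltW g0)//; lra.
by rewrite ler_pdivrMr ?marg_gt0// /marg; lra.
Qed.

(** On [[-T, T]] the integrand is [alpha (phi / marg) (1 + x^2) g], of order [alpha]; outside, the
    slab weight is bounded by 1 and the choice of [T] makes the Gaussian tail of order [alpha]. The
    two parts give 520 as [2 * 256 + 8]. *)
Lemma noise_moment alpha T : 0 < alpha -> alpha <= 1 / 2 -> 1 <= T ->
  expR (- (T ^+ 2 / 8)) <= alpha ->
  intble (fun x => phi x * (apost alpha x * (1 + x ^+ 2))) /\
  I (fun x => phi x * (apost alpha x * (1 + x ^+ 2))) <= 520 * Kwide * (alpha * T).
Proof.
move=> a0 a1 T1 hT; have aI : 0 <= alpha <= 1 by apply/andP; split; lra.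
have K0 := @Kwide_gt0 R.
pose h x := 256 * Kwide * alpha * \1_(`[(- T), T] : set R) x + 8 * alpha * wide 0 x.
have TT : - T <= T by lra.
have ih : intble h.
  by apply: intbleD; [exact/intbleZ/intble_indic|exact/intbleZ/intble_wide].
have m : measurable_fun setT (fun x => phi x * (apost alpha x * (1 + x ^+ 2))).
  apply: measurable_funM; first exact: meas_phi.
  apply: measurable_funM; first exact: meas_apost.
  by apply: measurable_funD => //; exact: measurable_funX.
have le x : 0 <= phi x * (apost alpha x * (1 + x ^+ 2)) <= h x.
  have x0 := sqr_ge0 x; have p0 := phi_gt0 x; have ap0 := apost_ge0 x aI.
  have ap1 := apost_le1 x aI; have w0 : 0 < wide 0 x by exact: expR_gt0.
  apply/andP; split.
    by apply: mulr_ge0; [exact: ltW|apply: mulr_ge0 => //; lra].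
  rewrite /h indicE; case: (boolP (x \in _)) => [|xT].
    move=> _; rewrite mulr1 apostE /slab_ratio.
    rewrite (_ : phi x * _ = alpha * (phi x / marg alpha x) * (gconv x * (1 + x ^+ 2))); last by ring.
    have := gconv_ub x; have := phi_marg x (ltW a0) a1; have g0 := gconv_gt0 x.
    set p := phi x / _ => p1 gu.
    have : alpha * p * (gconv x * (1 + x ^+ 2)) <= alpha * 2 * (128 * Kwide).
      rewrite ler_pM//; [|by rewrite mulr_ge0//; lra|by rewrite ler_pM2l//; lra].
      by rewrite mulr_ge0 ?divr_ge0 ?(ltW p0) ?(ltW (marg_gt0 _ aI))//; lra.
    have w8 : 0 <= 8 * alpha * wide 0 x by rewrite !mulr_ge0 ?(ltW w0)//; lra.
    by lra.
  have xT2 : T ^+ 2 <= x ^+ 2.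
    have : ~~ (- T <= x <= T).
      by apply: contra xT => xT; rewrite mem_set//= in_itv.
    rewrite negb_and -!ltNge => /orP[h1|h1]; nra.
  rewrite mulr0 add0r.
  have e1 : (1 + x ^+ 2) <= 8 * expR (x ^+ 2 / 8).
    by have := expR_ge1Dx (x ^+ 2 / 8); lra.
  (* The exponent is cut in three: one eighth yields [alpha], another cancels the growth of
     [1 + x^2], and the remaining quarter is integrable. *)
  have e2 : phi x <= expR (- (x ^+ 2 / 8)) * expR (- (x ^+ 2 / 8)) * wide 0 x.
    rewrite /phi /wide subr0 -!expRD.
    rewrite (_ : _ + _ + _ = - x ^+ 2 / 2); last lra.
    have s1 := @sqrt2pi_ge1 R; rewrite ler_pdivrMr; last lra.
    by rewrite ler_peMr ?expR_ge0.
  have e3 : expR (- (x ^+ 2 / 8)) <= alpha by apply: le_trans hT; rewrite ler_expR; lra.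
  have e4 : expR (- (x ^+ 2 / 8)) * expR (x ^+ 2 / 8) = 1 by rewrite -expRD addNr expR0.
  move: e1 e2 e3 e4; set E := expR (- _); set F := expR _; set w := wide 0 x in w0 *.
  move=> e1 e2 e3 e4.
  have E0 : 0 < E by exact: expR_gt0.
  have : phi x * (apost alpha x * (1 + x ^+ 2)) <= E * E * w * (8 * F).
    apply: ler_pM => //; [exact: ltW|by apply: mulr_ge0 => //; lra|].
    by apply: le_trans e1; rewrite ler_piMl//; lra.
  have -> : E * E * w * (8 * F) = 8 * (E * F) * E * w by ring.
  rewrite e4 => h1; apply: le_trans h1 _; rewrite ler_pM2r//; lra.
have i := intble_le m le ih; split=> //.
apply: le_trans (I_le i ih _) _; first by move=> x; have /andP[] := le x.
rewrite I_D ?I_Z ?I_indic ?I_wide//; try exact: intble_indic; try exact: intble_wide;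
  try by apply: intbleZ; try exact: intble_indic; exact: intble_wide.
have : 8 * alpha * Kwide <= 8 * alpha * Kwide * T.
  by rewrite ler_peMr// !mulr_ge0 ?(ltW K0)//; lra.
lra.
Qed.

Lemma phi_moment m :
  intble (fun x => phi (x - m) * (1 + (x - m) ^+ 2)) /\
  I (fun x => phi (x - m) * (1 + (x - m) ^+ 2)) <= 64 * Kwide.
Proof.
have le x : 0 <= phi (x - m) * (1 + (x - m) ^+ 2) <= 64 * wide m x.
  have := phi_wide m x; rewrite phiC; have := phi_ge0 (x - m); have := sqr_ge0 (x - m).
  set y := (x - m) ^+ 2; set p := phi _ => y0 p0 h.
  by apply/andP; split; nra.
have iw := intble_wide m.
have i : intble (fun x => phi (x - m) * (1 + (x - m) ^+ 2)).
  apply: intble_le le (intbleZ 64 iw).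
  apply: measurable_funM; first exact: intble_meas (intble_phi m).
  by apply: measurable_funD => //; apply: measurable_funX; exact: measurable_funB.
split=> //; rewrite -(I_wide m) -I_Z//; apply: I_le => //; first exact: intbleZ.
by move=> x; have /andP[] := le x.
Qed.

Lemma slab_ratio_le alpha x : 0 < alpha -> alpha <= 1 -> alpha * slab_ratio alpha x <= 1.
Proof. by move=> a0 a1; rewrite -apostE apost_le1// a1 ltW. Qed.

Lemma intble_ratio alpha : 0 < alpha -> alpha <= 1 ->
  intble (fun x => phi x * slab_ratio alpha x).
Proof.
move=> a0 a1; have aI : 0 <= alpha <= 1 by rewrite a1 ltW.
have ip : intble (@phi R) by have := @intble_phi R 0; under eq_fun do rewrite subr0.
apply: intble_le (intbleZ alpha^-1 ip).
  by apply: measurable_funM; [exact: meas_phi|exact: meas_slab_ratio].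
move=> x; have p0 := phi_ge0 x; rewrite mulr_ge0 ?slab_ratio_ge0//= mulrC ler_wpM2r//.
by rewrite -[leRHS]mul1r ler_pdivlMr// mulrC slab_ratio_le.
Qed.

(* Where alpha g >= 2 phi, at least half of g is lost in g phi / marg. *)
Lemma ratio_mean alpha T : 0 < alpha -> alpha <= 1 / 2 -> 1 <= T ->
  2 <= alpha * (cw * expR (T ^+ 2 / 4)) -> alpha <= cg / (40 * T) ->
  I (fun x => phi x * slab_ratio alpha x) <= 1 - cg / (20 * T).
Proof.
move=> a0 a1 T1 hT aT; have aI : 0 <= alpha <= 1 by apply/andP; split; lra.
have c0 := @cg_gt0 R; pose k : R := cg / (1 + 4 * T ^+ 2) / 2.
have ir : intble (fun x => phi x * slab_ratio alpha x) by apply: intble_ratio; lra.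
have ii : intble (\1_(`[T, 2 * T] : set R)) by apply: intble_indic; lra.
have k0 : 0 < k by rewrite /k !divr_gt0//; nra.
(* The loss [k] over an interval of length [T] totals at least [cg / (10 T)]; the excess [2 alpha]
   allowed everywhere is at most half of that. *)
have : I (fun x => phi x * slab_ratio alpha x + k * \1_(`[T, 2 * T] : set R) x) <=
       I (fun x => (1 + 2 * alpha) * gconv x).
  apply: I_le; [by apply: intbleD => //; exact: intbleZ|by apply: intbleZ; exact: intble_gconv|].
  move=> x; have p0 := phi_gt0 x; have g0 := gconv_gt0 x.
  have e : phi x * slab_ratio alpha x = phi x / marg alpha x * gconv x.
    by rewrite /slab_ratio; ring.
  rewrite indicE; case: (boolP (x \in _)) => [|_].
    rewrite inE /= in_itv /= mulr1 => /andP[x1 x2].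
    have h1 : phi x / marg alpha x <= 2^-1.
      rewrite ler_pdivrMr ?marg_gt0//; have := slab_lb x.
      set E := expR _ => gE.
      have EE : expR (T ^+ 2 / 4) <= E by rewrite ler_expR; nra.
      have cwp := @cw_gt0 R.
      have h2 : 2 <= alpha * (cw * E).
        by apply: le_trans hT _; rewrite ler_pM2l// ler_pM2l.
      have h3 : 2 * phi x <= alpha * gconv x.
        have : 2 * phi x <= alpha * (cw * E) * phi x by rewrite ler_pM2r.
        have : alpha * (cw * E * phi x) <= alpha * gconv x by rewrite ler_pM2l.
        lra.
      by rewrite /marg; nra.
    have h2 : k <= gconv x / 2.
      rewrite /k ler_pM2r ?invr_gt0//; apply: le_trans (gconv_lb x).
      by rewrite ler_pM2l// lef_pV2 ?posrE; nra.
    rewrite e; nra.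
  rewrite mulr0 addr0 e ler_pM2r//; exact: phi_marg (ltW a0) a1.
rewrite I_D ?I_Z ?I_indic ?I_gconv//; try lra; try exact: intble_gconv; last exact: intbleZ.
move=> h; have kT : cg / (10 * T) <= k * (2 * T - T).
  rewrite (_ : k * (2 * T - T) = cg * (T / (2 * (1 + 4 * T ^+ 2)))); last first.
    by rewrite /k; field; rewrite gt_eqF//; nra.
  rewrite ler_pM2l// ler_pdivlMr ?mulr_gt0//; try nra.
  rewrite mulrC ler_pdivrMr; nra.
have e1 : cg / (10 * T) = 4 * (cg / (40 * T)) by field; rewrite gt_eqF//; lra.
have e2 : cg / (20 * T) = 2 * (cg / (40 * T)) by field; rewrite gt_eqF//; lra.
lra.
Qed.

(** Square and invert [exp (- y / 2) >= 1 - y / 2]. *)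
Lemma expR_le_quad (y : R) : y <= 1 / 4 -> expR y <= 1 + y + y ^+ 2.
Proof.
move=> y1; have h1 := expR_ge1Dx (- (y / 2)).
have h2 : expR (- (y / 2)) ^+ 2 * expR y = 1.
  by rewrite expr2 -!expRD (_ : _ + _ = 0) ?expR0//; lra.
have h3 : (1 - y / 2) ^+ 2 <= expR (- (y / 2)) ^+ 2.
  by rewrite ler_sqr ?nnegrE//; have := expR_gt0 (- (y / 2)); lra.
have e0 := expR_gt0 y.
have h4 : (1 - y / 2) ^+ 2 * expR y <= 1 by move: h3; rewrite -(ler_pM2r e0) h2.
have h5 : 1 <= (1 - y / 2) ^+ 2 * (1 + y + y ^+ 2).
  rewrite -subr_ge0 (_ : _ - _ = (y / 2) ^+ 2 * (1 - 3 * y + y ^+ 2)); last by field.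
  rewrite mulr_ge0 ?sqr_ge0//; have := sqr_ge0 y; lra.
have h6 : 0 < (1 - y / 2) ^+ 2 by rewrite exprn_gt0//; lra.
by rewrite -(ler_pM2l h6); lra.
Qed.

(** Second-order expansion with step [l = m alpha / 4]. As [r <= 1 / alpha], the exponent is at most
    1/4 and [r^2 <= r / alpha], so the quadratic terms use up at most half of the first-order gain
    [l m]. *)
Lemma ratio_exp alpha m : 0 < alpha -> alpha <= 1 -> 0 <= m -> m <= 1 ->
  I (fun x => phi x * slab_ratio alpha x) <= 1 - m ->
  let e x := expR (m * alpha / 4 * (slab_ratio alpha x - 1)) in
  [/\ measurable_fun setT e, forall x, e x <= expR 1,
    intble (fun x => phi x * e x) &
    I (fun x => phi x * e x) <= 1 - m * alpha / 4 * m / 2].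
Proof.
move=> a0 a1 m0 m1 hm e; set l := m * alpha / 4 in e *.
have aI : 0 <= alpha <= 1 by rewrite a1 ltW.
have l0 : 0 <= l by rewrite /l divr_ge0// mulr_ge0// ltW.
have lr x : l * (slab_ratio alpha x - 1) <= 1 / 4.
  have := slab_ratio_le x a0 a1; set r := slab_ratio _ _ => h.
  have : l * r <= 1 / 4 by rewrite /l; nra.
  lra.
have me : measurable_fun setT e.
  apply: measurableT_comp => //; apply: measurable_funM => //.
  by apply: measurable_funB => //; exact: meas_slab_ratio.
have ip : intble (@phi R) by have := @intble_phi R 0; under eq_fun do rewrite subr0.
have Ip : I (@phi R) = 1 by rewrite -[RHS](I_phi (0 : R)); under [RHS]eq_Rintegral do rewrite subr0.
have e1 x : e x <= expR 1 by rewrite ler_expR; have := lr x; lra.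
have ie : intble (fun x => phi x * e x).
  apply: intble_le (intbleZ (expR 1) ip); first exact: measurable_funM meas_phi me.
  by move=> x; rewrite mulr_ge0 ?phi_ge0 ?expR_ge0//= mulrC ler_wpM2r ?phi_ge0.
split=> //.
have ir := intble_ratio a0 a1.
have key x : phi x * e x <= (1 + l ^+ 2 - l) * phi x + (l + l ^+ 2 / alpha) * (phi x * slab_ratio alpha x).
  have p0 := phi_gt0 x; have := expR_le_quad (lr x); rewrite -/(e x).
  have := slab_ratio_le x a0 a1; have := slab_ratio_ge0 x aI; set r := slab_ratio _ _ => r0 ra h.
  have : r ^+ 2 <= r / alpha by rewrite ler_pdivlMr//; nra.
  move=> h1; have : (l * (r - 1)) ^+ 2 <= l ^+ 2 * (1 + r / alpha).
    by rewrite exprMn ler_wpM2l ?sqr_ge0//; nra.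
  move=> h2; have : e x <= (1 + l ^+ 2 - l) + (l + l ^+ 2 / alpha) * r by lra.
  nra.
apply: le_trans (I_le ie _ key) _.
  by apply: intbleD; exact: intbleZ.
rewrite I_D ?I_Z ?Ip//; try exact: intbleZ.
have la : l ^+ 2 / alpha = l * m / 4 by rewrite /l; field; rewrite gt_eqF.
rewrite la.
have : (l + l * m / 4) * I (fun x => phi x * slab_ratio alpha x) <= (l + l * m / 4) * (1 - m).
  by rewrite ler_wpM2l//; nra.
have : l ^+ 2 <= l * m / 4 by rewrite /l; nra.
nra.
Qed.

Lemma exp_moment (e : R -> R) : measurable_fun setT e ->
  (forall x, 0 <= e x) -> (forall x, e x <= expR 1) ->
  intble (fun x => phi x * ((1 + x ^+ 2) * e x)) /\
  I (fun x => phi x * ((1 + x ^+ 2) * e x)) <= expR 1 * (64 * Kwide).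
Proof.
move=> me e0 e1; have [i0 I0] := phi_moment 0.
have i1 : intble (fun x => phi x * (1 + x ^+ 2)) by move: i0; under eq_fun do rewrite subr0.
have I1 : I (fun x => phi x * (1 + x ^+ 2)) <= 64 * Kwide.
  by move: I0; under eq_Rintegral do rewrite subr0.
have le x : 0 <= phi x * ((1 + x ^+ 2) * e x) <= expR 1 * (phi x * (1 + x ^+ 2)).
  have p0 : 0 <= phi x * (1 + x ^+ 2) by rewrite mulr_ge0 ?phi_ge0//; have := sqr_ge0 x; lra.
  by rewrite mulrA mulr_ge0//= mulrC ler_wpM2r.
have i : intble (fun x => phi x * ((1 + x ^+ 2) * e x)).
  apply: intble_le le (intbleZ _ i1); apply: measurable_funM; first exact: meas_phi.
  by apply: measurable_funM => //; apply: measurable_funD => //; exact: measurable_funX.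
split=> //; apply: le_trans (I_le i (intbleZ (expR 1) i1) _) _.
  by move=> x; have /andP[] := le x.
by rewrite I_Z// ler_wpM2l ?expR_ge0.
Qed.

End NullMoments.

(** * Iterated Gaussian integrals *)

Section GaussIter.
Context {R : realType}.
Local Open Scope classical_set_scope.
Local Open Scope ring_scope.
Notation mu := (@lebesgue_measure R).
Notation I f := (Rintegral mu setT f).
Implicit Types (theta X : nat -> R) (F : (nat -> R) -> \bar R).

(* No measurability: the integral of a nonnegative function is a supremum over
   simple functions below it. *)
Lemma integral_mono (f h : R -> \bar R) : (forall x, (0 <= f x)%E) ->
  (forall x, (f x <= h x)%E) -> (\int[mu]_x f x <= \int[mu]_x h x)%E.
Proof.
move=> f0 fh; rewrite !ge0_integralTE//; last by move=> x; exact: le_trans (fh x).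
apply: le_ereal_sup => _ [g /= gf <-]; exists g => //= x.
exact: le_trans (gf x) (fh x).
Qed.

Lemma gauss_iter_ge0 m theta F X : (forall X, (0 <= F X)%E) ->
  (0 <= gauss_iter m theta F X)%E.
Proof.
move=> F0; elim: m X => [|m IH] X //=; apply: integral_ge0 => y _.
by rewrite mule_ge0// lee_fin phi_ge0.
Qed.

Lemma intble_sum (K : Type) (s : seq K) (c : K -> R) (h : K -> R -> R) :
  (forall k, intble (h k)) ->
  intble (fun x => \sum_(k <- s) c k * h k x) /\
  I (fun x => \sum_(k <- s) c k * h k x) = \sum_(k <- s) c k * I (h k).
Proof.
move=> ih; elim: s => [|k s [IH1 IH2]].
  split; first by under eq_fun do rewrite big_nil; exact: integrable0.
  by under eq_fun do rewrite big_nil; rewrite big_nil /Rintegral integral0.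
have ik := intbleZ (c k) (ih k).
under eq_fun do rewrite big_cons.
split; first exact: intbleD.
by rewrite big_cons I_D// I_Z// IH2.
Qed.

(** Induction on the number of coordinates integrated out, each of which replaces its factor by the
    bound [M]. Only the dominating sum of products has to be integrable, so nothing is asked of [F]
    beyond its sign. *)
Lemma gauss_iter_le (K : finType) n theta F (f : K -> nat -> R -> R) (M : K -> nat -> R) :
  (forall X, (0 <= F X)%E) ->
  (forall k i x, 0 <= f k i x) ->
  (forall k i, intble (fun y => phi (y - theta i) * f k i y)) ->
  (forall k i, I (fun y => phi (y - theta i) * f k i y) <= M k i) ->
  (forall X, (F X <= (\sum_k \prod_(i < n) f k i (X i))%:E)%E) ->
  forall m X, (m <= n)%N ->
  (gauss_iter m theta F X <=
    (\sum_k \prod_(i < n) (if (i < m)%N then M k i else f k i (X i)))%:E)%E.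
Proof.
move=> F0 f0 fi fM FX; elim=> [|m IH] X mn /=; first exact: FX.
pose im := Ordinal mn.
have M0 k i : 0 <= M k i.
  by apply: le_trans (fM k i); apply: I_ge0 => y; rewrite mulr_ge0 ?phi_ge0.
(* The factors of the other coordinates, constant in the variable being integrated. *)
pose c k := \prod_(i < n | i != im) (if (i < m)%N then M k i else f k i (X i)).
have c0 k : 0 <= c k by apply: prodr_ge0 => i _; case: ifP.
have [i1 I1] := intble_sum (index_enum K) c (h := fun k y => phi (y - theta m) * f k m y)
  (fun k => fi k m).
apply: (@le_trans _ _ (\int[mu]_y (\sum_k c k * (phi (y - theta m) * f k m y))%:E)%E).
  apply: integral_mono => y.
    by rewrite mule_ge0// ?lee_fin ?phi_ge0//; exact: gauss_iter_ge0.
  apply: (@le_trans _ _ ((phi (y - theta m))%:E *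
      (\sum_k \prod_(i < n) (if (i < m)%N then M k i else f k i (upd X m y i)))%:E)%E).
    by apply: lee_wpmul2l; [rewrite lee_fin phi_ge0|apply: IH; exact: ltnW].
  rewrite -EFinM lee_fin mulr_sumr le_eqVlt; apply/orP; left; apply/eqP.
  apply: eq_bigr => k _; rewrite (bigD1 im)//= ltnn /upd eqxx.
  rewrite [LHS]mulrA [LHS]mulrC; congr (_ * _); apply: eq_bigr => i im'.
  case: ifP => // _; case: eqP => // e; move: im'; rewrite -val_eqE /= e.
  by rewrite eqxx.
rewrite EFin_I// lee_fin I1; apply: ler_sum => k _.
rewrite [leRHS](bigD1 im)//= ltnSn mulrC.
apply: ler_pM => //.
- by apply: I_ge0 => y; rewrite mulr_ge0 ?phi_ge0.
- rewrite le_eqVlt; apply/orP; left; apply/eqP; apply: eq_bigr => i im'.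
  rewrite [in RHS]ltnS [in RHS]leq_eqVlt; case: eqP => // e.
  by move: im'; rewrite -val_eqE /= e eqxx.
Qed.

Lemma Eth_le (K : finType) n theta F (f : K -> nat -> R -> R) (M : K -> nat -> R) :
  (forall X, (0 <= F X)%E) ->
  (forall k i x, 0 <= f k i x) ->
  (forall k i, intble (fun y => phi (y - theta i) * f k i y)) ->
  (forall k i, I (fun y => phi (y - theta i) * f k i y) <= M k i) ->
  (forall X, (F X <= (\sum_k \prod_(i < n) f k i (X i))%:E)%E) ->
  (Eth n theta F <= (\sum_k \prod_(i < n) M k i)%:E)%E.
Proof.
move=> F0 f0 fi fM FX.
apply: le_trans (gauss_iter_le F0 f0 fi fM FX _ (leqnn n)) _.
rewrite lee_fin le_eqVlt; apply/orP; left; apply/eqP.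
by apply: eq_bigr => k _; apply: eq_bigr => i _; rewrite ltn_ord.
Qed.
End GaussIter.

(** * Risk bound at a comparison weight *)

Section Core.
Context {R : realType}.
Local Open Scope classical_set_scope.
Local Open Scope ring_scope.
Notation mu := (@lebesgue_measure R).
Notation I f := (Rintegral mu setT f).
Implicit Types (theta X : nat -> R) (n s : nat) (alpha T b l : R).

Lemma in_l0_card n s theta : in_l0 n s theta ->
  (#|[pred i : 'I_n | theta i != 0%R]| <= s)%N.
Proof.
rewrite /in_l0; congr (_ <= _)%N; apply: eq_card => i.
by rewrite !inE; exact: asboolb.
Qed.

Lemma sum_signal_le n s theta (c : R) : in_l0 n s theta -> 0 <= c ->
  \sum_(i < n | theta i != 0) c <= s%:R * c.
Proof.
move=> /in_l0_card h c0; rewrite (sumr_const [pred i : 'I_n | theta i != 0]).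
by rewrite -[leLHS]mulr_natl ler_wpM2r// ler_nat.
Qed.

(* On {ahat > alpha} the score at alpha is nonnegative, so 1 is at most the
   exponential of any positive multiple of it. *)
Lemma apost_exceed n s theta X alpha b l : 0 < alpha -> alpha <= 1 -> 0 <= b -> b <= 1 ->
  in_l0 n s theta -> 0 <= l -> loglik n alpha X <= loglik n b X ->
  forall x, apost b x <= apost alpha x + expR (l * s%:R / alpha) *
    \prod_(j < n | theta j == 0) expR (l * (slab_ratio alpha (X j) - 1)).
Proof.
move=> a0 a1 b0 b1 hs l0 hl x; have aI : 0 <= alpha <= 1 by rewrite a1 ltW.
have P0 : 0 <= \prod_(j < n | theta j == 0) expR (l * (slab_ratio alpha (X j) - 1)).
  by apply: prodr_ge0 => j _; exact: expR_ge0.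
have [ba|ab] := leP b alpha.
  apply: (le_trans (apost_mono x b0 ba a1)).
  by rewrite lerDl mulr_ge0 ?expR_ge0.
have := score_ge (ltW a0) ab b1 hl; rewrite -subr_ge0.
rewrite (_ : n%:R = \sum_(i < n) 1); last by rewrite sumr_const card_ord.
rewrite -sumrB (bigID (fun i : 'I_n => theta i != 0)) /=.
have sg : \sum_(i < n | theta i != 0) (slab_ratio alpha (X i) - 1) <= s%:R * alpha^-1.
  apply: le_trans (sum_signal_le hs _); last by rewrite invr_ge0 ltW.
  apply: ler_sum => i _; rewrite -[leRHS]mul1r ler_pdivlMr//.
  by have := slab_ratio_le (X i) a0 a1; lra.
rewrite [X in _ + X](eq_bigl (fun i : 'I_n => theta i == 0)); last first.
  by move=> i /=; rewrite negbK.
rewrite -expR_sum -expRD -mulr_sumr -mulrA -mulrDr.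
set A := \sum_(i < n | _ != _) _ in sg *; set B := \sum_(i < n | _ == _) _ => AB.
have h1 : 1 <= expR (l * (s%:R / alpha + B)).
  by rewrite -{1}expR0 ler_expR mulr_ge0//; lra.
have := apost_le1 x (introT andP (conj b0 b1)).
by have := apost_ge0 x aI; lra.
Qed.

Definition Cn : R := 2 * Cm + 2.

Lemma Cn_gt0 : 0 < Cn. Proof. by have := @Cm_gt0 R; rewrite /Cn; lra. Qed.

(** The bound per signal from [signals_sum], doubled as in [post_sq_signal]. *)
Definition Cs (z : R) : R := 2 * (8 / cw + 8 + 8 * kap + 8 * ln z).

(** The deterministic signal bound is spread evenly over all [n] coordinates, so that the first part
    is a sum of functions of single coordinates. *)
Lemma risk_le n s theta X alpha b l : (0 < s)%N -> (s <= n)%N ->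
  0 < alpha -> alpha <= 1 -> 0 < b -> b <= 1 ->
  in_l0 n s theta -> 0 <= l -> loglik n alpha X <= loglik n b X ->
  (forall a, b <= a <= 1 -> loglik n a X <= loglik n b X) ->
  (post_risk n b theta X <=
   (\sum_(i < n) (s%:R * Cs (n%:R / s%:R) / n%:R +
       (if theta i != 0 then 2 * (X i - theta i) ^+ 2 + 2 * Cm
        else Cn * (apost alpha (X i) * (1 + X i ^+ 2)))) +
    \sum_(i < n | theta i == 0) Cn * (1 + X i ^+ 2) *
       (expR (l * s%:R / alpha) *
    \prod_(j < n | theta j == 0) expR (l * (slab_ratio alpha (X j) - 1))))%:E)%E.
Proof.
move=> s0 sn a0 a1 b0 b1 hs l0 hl hb.
have bI : 0 <= b <= 1 by rewrite b1 ltW.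
set P := expR _ * _.
have n0 : 0 < n%:R :> R by rewrite ltr0n (leq_trans s0).
apply: (@le_trans _ _ (\sum_(i < n) ((if theta i != 0 then
   2 * ((1 - apost b (X i)) * X i ^+ 2) else 0) +
   ((if theta i != 0 then 2 * (X i - theta i) ^+ 2 + 2 * Cm
        else Cn * (apost alpha (X i) * (1 + X i ^+ 2))) +
    (if theta i == 0 then Cn * (1 + X i ^+ 2) * P else 0)))%:E)%E).
  apply: lee_sum => i _; case: (eqVneq (theta i) 0) => [->|ti] /=.
    apply: le_trans (post_sq_null _ bI) _; rewrite lee_fin -/Cn add0r.
    rewrite [leRHS](_ : _ = Cn * ((apost alpha (X i) + P) * (1 + X i ^+ 2))); last by ring.
    rewrite ler_pM2l ?Cn_gt0// ler_wpM2r//.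
      by have := sqr_ge0 (X i); lra.
    exact: (apost_exceed a0 a1 (ltW b0) b1 hs l0 hl).
  apply: le_trans (post_sq_signal _ _ bI) _; rewrite lee_fin; lra.
rewrite sumEFin lee_fin big_split /= big_split /= [in leRHS]big_split /=.
rewrite -[X in _ + (_ + X) <= _]big_mkcond /= addrA lerD2r lerD2r.
rewrite sumr_const card_ord -[leRHS]mulr_natl mulrC divfK ?gt_eqF//.
rewrite -big_mkcond /= -mulr_sumr /Cs mulrCA ler_pM2l//.
apply: signals_sum => //; first exact: in_l0_card hs.
(* The weight [2 b] is above [b] and still at most 1, so the maximiser can be compared with it. *)
move=> b2; apply: (score_le (a := b)); [exact: ltW|lra|lra|].
by apply: hb; apply/andP; split; lra.
Qed.

(** * Domination by products over the coordinates *)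

Definition tilt alpha l (y : R) : R := expR (l * (slab_ratio alpha y - 1)).

Definition add_fac theta alpha (D : R) (i : nat) (y : R) : R :=
  D + (if theta i != 0 then 2 * (y - theta i) ^+ 2 + 2 * Cm
       else Cn * (apost alpha y * (1 + y ^+ 2))).

Definition dev_fac theta alpha l (C : R) (i : nat) (y : R) : R :=
  if theta i != 0 then 0 else C * ((1 + y ^+ 2) * tilt alpha l y).

(* The risk is dominated by the sum over k of the products over i of fac k i:
   k = (j, true) carries the risk of coordinate j on {ahat <= alpha}, and
   k = (j, false) carries it on {ahat > alpha}. *)
Definition fac n theta alpha l (D C : R) (k : 'I_n * bool) (i : nat) (y : R) : R :=
  if k.2 then (if i == k.1 then add_fac theta alpha D i y else 1)
  else (if i == k.1 then dev_fac theta alpha l C i y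
        else if theta i != 0 then 1 else tilt alpha l y).

(** Bounds for the Gaussian means of [fac]. The tilted factors are written as exponentials so that
    their product becomes a sum over the null coordinates. *)
Definition mom n theta (D N B x : R) (k : 'I_n * bool) (i : nat) : R :=
  if k.2 then
    (if i == k.1 then D + (if theta i != 0 then 128 * Kwide + 2 * Cm else N) else 1)
  else (if i == k.1 then (if theta i != 0 then 0 else B)
        else expR (- (if theta i != 0 then 0 else x))).

Lemma add_fac_moment theta alpha (D M : R) i :
  let h y := phi y * (apost alpha y * (1 + y ^+ 2)) in
  intble h -> I h <= M ->
  intble (fun y => phi (y - theta i) * add_fac theta alpha D i y) /\
  I (fun y => phi (y - theta i) * add_fac theta alpha D i y) <=
  D + (if theta i != 0 then 128 * Kwide + 2 * Cm else Cn * M).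
Proof.
move=> h ih Ih; have ip := @intble_phi R (theta i); have Ip := @I_phi R (theta i).
rewrite /add_fac; case: eqVneq => ti /=.
  have E y : phi (y - theta i) * (D + Cn * (apost alpha y * (1 + y ^+ 2))) =
    D * phi (y - theta i) + Cn * h y.
    by rewrite /h ti subr0; ring.
  under eq_fun do rewrite E.
  split; first by apply: intbleD; exact: intbleZ.
  rewrite I_D ?I_Z ?Ip//; try exact: intbleZ.
  by rewrite mulr1 lerD2l ler_pM2l ?Cn_gt0.
have [i2 I2] := phi_moment (theta i).
have E y : phi (y - theta i) * (D + (2 * (y - theta i) ^+ 2 + 2 * Cm)) =
    (D + 2 * Cm - 2) * phi (y - theta i) +
    2 * (phi (y - theta i) * (1 + (y - theta i) ^+ 2)) by ring.
under eq_fun do rewrite E.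
split; first by apply: intbleD; exact: intbleZ.
rewrite I_D ?I_Z ?Ip//; try exact: intbleZ.
by clear ih Ih; lra.
Qed.

Lemma dev_fac_moment theta alpha l (C M : R) i : 0 <= C ->
  let h y := phi y * ((1 + y ^+ 2) * tilt alpha l y) in
  intble h -> I h <= M ->
  intble (fun y => phi (y - theta i) * dev_fac theta alpha l C i y) /\
  I (fun y => phi (y - theta i) * dev_fac theta alpha l C i y) <=
  (if theta i != 0 then 0 else C * M).
Proof.
move=> C0 h ih Ih; rewrite /dev_fac; case: eqVneq => ti /=.
  have E y : phi (y - theta i) * (C * ((1 + y ^+ 2) * tilt alpha l y)) = C * h y.
    by rewrite /h ti subr0; ring.
  under eq_fun do rewrite E.
  split; first exact: intbleZ.
  by rewrite I_Z// ler_wpM2l.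
under eq_fun do rewrite mulr0.
split; first exact: integrable0.
by rewrite /Rintegral integral0.
Qed.

Lemma tilt_moment theta alpha l (x : R) i :
  intble (fun y => phi y * tilt alpha l y) ->
  I (fun y => phi y * tilt alpha l y) <= 1 - x ->
  intble (fun y => phi (y - theta i) * (if theta i != 0 then 1 else tilt alpha l y)) /\
  I (fun y => phi (y - theta i) * (if theta i != 0 then 1 else tilt alpha l y)) <=
    expR (- (if theta i != 0 then 0 else x)).
Proof.
move=> ih Ih; case: eqVneq => ti /=; last first.
  under eq_fun do rewrite mulr1; rewrite oppr0 expR0 I_phi.
  by split => //; exact: intble_phi.
under eq_fun do rewrite ti subr0.
by split => //; apply: le_trans Ih _; exact: expR_ge1Dx.
Qed.

Lemma sqr1D_ge0 (y : R) : 0 <= 1 + y ^+ 2. Proof. by rewrite addr_ge0 ?sqr_ge0. Qed.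

Lemma fac_ge0 n theta alpha l (D C : R) (k : 'I_n * bool) i y :
  0 <= alpha <= 1 -> 0 <= D -> 0 <= C -> 0 <= fac theta alpha l D C k i y.
Proof.
move=> aI D0 C0; have t0 : 0 <= tilt alpha l y by exact: expR_ge0.
rewrite /fac; case: ifP => _; case: ifP => _ //; last by case: ifP.
  rewrite /add_fac addr_ge0//; case: ifP => _.
    by apply: addr_ge0; apply: mulr_ge0 => //; [exact: sqr_ge0|exact/ltW/Cm_gt0].
  apply: mulr_ge0; first exact/ltW/Cn_gt0.
  by apply: mulr_ge0; [exact: apost_ge0|exact: sqr1D_ge0].
rewrite /dev_fac; case: ifP => _ //.
by apply: mulr_ge0 => //; apply: mulr_ge0 => //; exact: sqr1D_ge0.
Qed.

Lemma sum_prod_bool n (F : 'I_n * bool -> R) :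
  \sum_k F k = \sum_(i < n) F (i, true) + \sum_(i < n) F (i, false).
Proof.
rewrite (eq_bigr (fun k => F (k.1, k.2))); last by case.
rewrite -(pair_big xpredT xpredT (fun i (c : bool) => F (i, c))) /=.
by under eq_bigr do rewrite big_bool; rewrite big_split.
Qed.

(** In the second sum the tilt of coordinate [i] itself is merged with [1 + X i ^+ 2] into
    [dev_fac], which vanishes at signals. *)
Lemma sum_fac n theta alpha l (D C : R) X :
  \sum_(i < n) add_fac theta alpha D i (X i) +
  \sum_(i < n | theta i == 0) C * (1 + X i ^+ 2) *
    \prod_(j < n | theta j == 0) tilt alpha l (X j) =
  \sum_(k : 'I_n * bool) \prod_(i < n) fac theta alpha l D C k i (X i).
Proof.
rewrite sum_prod_bool; congr (_ + _).
  apply: eq_bigr => i _; rewrite (bigD1 i)//= /fac /= eqxx big1 ?mulr1//.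
  by move=> j ji; rewrite -val_eqE in ji; rewrite (negbTE ji).
rewrite big_mkcond /=; apply: eq_bigr => i _.
rewrite [RHS](bigD1 i)//= /fac /= eqxx /dev_fac.
case: eqVneq => ti /=; last by rewrite mul0r.
rewrite (bigD1 i)//=; last by rewrite ti.
rewrite [RHS](_ : _ = C * ((1 + X i ^+ 2) * tilt alpha l (X i)) *
  \prod_(j < n | (theta j == 0) && (j != i)) tilt alpha l (X j)); first by ring.
congr (_ * _); rewrite (bigID (fun j : 'I_n => theta j == 0)) /= [X in _ * X]big1 ?mulr1.
  rewrite (eq_bigl (fun j : 'I_n => (theta j == 0) && (j != i))); last by move=> j; rewrite andbC.
  apply: eq_bigr => j /andP[tj ji]; rewrite -val_eqE in ji.
  by rewrite (negbTE ji) tj.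
by move=> j /andP[ji tj]; rewrite -val_eqE in ji; rewrite (negbTE ji) tj.
Qed.

(** In the exponent, [n - s] bounds the number of null coordinates from below, and 1 is removed for
    the coordinate that carries the risk. *)
Lemma sum_mom_le n s theta (D N B x : R) : in_l0 n s theta ->
  0 <= N -> 0 <= B -> 0 <= x ->
  \sum_(k : 'I_n * bool) \prod_(i < n) mom theta D N B x k i <=
  n%:R * D + s%:R * (128 * Kwide + 2 * Cm) + n%:R * N +
  n%:R * (B * expR (- (x * (n%:R - s%:R - 1)))).
Proof.
move=> hs N0 B0 x0; rewrite sum_prod_bool; apply: lerD.
  rewrite (eq_bigr (fun i : 'I_n => D + (if theta i != 0 then 128 * Kwide + 2 * Cm else N))); last first.
    move=> i _; rewrite (bigD1 i)//= /mom /= eqxx big1 ?mulr1//.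
    by move=> j ji; rewrite -val_eqE in ji; rewrite (negbTE ji).
  rewrite big_split /= sumr_const card_ord -[D *+ n]mulr_natl -addrA lerD2l.
  rewrite (bigID (fun i : 'I_n => theta i != 0)) /=; apply: lerD.
    rewrite (eq_bigr (fun _ => 128 * Kwide + 2 * Cm)); last by move=> i ->.
    apply: sum_signal_le => //; apply: addr_ge0; apply: mulr_ge0.
    - exact: ler0n.
    - exact/ltW/Kwide_gt0.
    - exact: ler0n.
    - exact/ltW/Cm_gt0.
  rewrite (eq_bigr (fun _ => N)); last by move=> i /negbTE ->.
  rewrite (sumr_const [pred i : 'I_n | ~~ (theta i != 0)]) -[leLHS]mulr_natl ler_wpM2r//.
  by rewrite ler_nat -[leqRHS]card_ord max_card.
rewrite [X in _ <= X * _](_ : n%:R = \sum_(i < n) 1); last by rewrite sumr_const card_ord.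
rewrite mulr_suml; apply: ler_sum => i _; rewrite mul1r.
rewrite (bigD1 i)//= /mom /= eqxx; case: eqVneq => ti /=.
  apply: ler_wpM2l => //; pose d (j : nat) := if theta j != 0 then 0 else x.
  rewrite (eq_bigr (fun j : 'I_n => expR (- d j))); last first.
    by move=> j ji; rewrite -val_eqE in ji; rewrite (negbTE ji).
  rewrite -expR_sum ler_expR sumrN lerN2.
  have e1 : \sum_(j < n) d j = x + \sum_(j < n | j != i) d j.
    by rewrite (bigD1 i)//= {1}/d ti eqxx.
  have e2 : n%:R * x <= \sum_(j < n) d j + s%:R * x.
    rewrite mulr_natl -[X in _ *+ X]card_ord -sumr_const.
    apply: (@le_trans _ _ (\sum_(j < n) d j + \sum_(j < n | theta j != 0) x)); last first.
      by rewrite lerD2l sum_signal_le.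
    rewrite [X in _ <= _ + X]big_mkcond -big_split /=; apply: ler_sum => j _.
    by rewrite /d; case: ifP; rewrite ?add0r ?addr0.
  rewrite e1 in e2; rewrite mulrC !mulrBl mul1r.
  by rewrite lerBlDl lerBlDr.
by rewrite mul0r mulr_ge0 ?expR_ge0.
Qed.

Lemma risk_le_weight n s theta (ahat : (nat -> R) -> R) alphan alpha T :
  (0 < s)%N -> (s <= n)%N -> in_l0 n s theta ->
  0 < alphan -> alphan <= alpha -> alpha <= 1 / 2 ->
  (forall X, alphan <= ahat X <= 1 /\
     forall a, alphan <= a <= 1 -> loglik n a X <= loglik n (ahat X) X) ->
  1 <= T -> expR (- (T ^+ 2 / 8)) <= alpha ->
  2 <= alpha * (cw * expR (T ^+ 2 / 4)) -> alpha <= cg / (40 * T) ->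
  forall m, m = cg / (20 * T) ->
  (Eth n theta (fun X => post_risk n (ahat X) theta X) <=
    (s%:R * Cs (n%:R / s%:R) + s%:R * (128 * Kwide + 2 * Cm)
     + n%:R * (Cn * (520 * Kwide * (alpha * T)))
     + n%:R * (Cn * expR (m * s%:R / 4) * (expR 1 * (64 * Kwide)) *
        expR (- (m * alpha / 4 * m / 2 * (n%:R - s%:R - 1)))))%:E)%E.
Proof.
move=> s0 sn hs an0 ana a2 ha T1 hT hT2 aT m mE.
have a0 : 0 < alpha by exact: lt_le_trans ana.
have a1 : alpha <= 1 by clear -a2; lra.
have aI : 0 <= alpha <= 1 by rewrite a1 ltW.
have m0 : 0 < m by rewrite mE divr_gt0 ?cg_gt0//; clear -T1; lra.
have m1 : m <= 1.
  rewrite mE ler_pdivrMr; clear -T1; last lra.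
  have : @cg R <= 1 by rewrite /cg invf_le1; have := @Kwide_gt0 R; have := @pi_ge1 R; nra.
  lra.
have := ratio_mean a0 a2 T1 hT2 aT; rewrite -mE => rm.
have [] := ratio_exp a0 a1 (ltW m0) m1 rm.
(* The step of [ratio_exp]; with it the signals contribute only [l s / alpha = m s / 4] to the
   exponent. *)
set l := m * alpha / 4; have l0 : 0 <= l.
  by apply: divr_ge0 => //; apply: mulr_ge0; exact: ltW.
set x := l * m / 2 => me e1 ie Ie.
have x0 : 0 <= x by apply: divr_ge0 => //; apply: mulr_ge0 => //; exact: ltW.
have [iq Iq] := exp_moment me (fun y => expR_ge0 _) e1.
have [iz Iz] := noise_moment a0 a2 T1 hT.
pose D : R := s%:R * Cs (n%:R / s%:R) / n%:R.
have n0 : 0 < n%:R :> R by rewrite ltr0n (leq_trans s0).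
have D0 : 0 <= D.
  apply: divr_ge0 => //; apply: mulr_ge0 => //; apply: mulr_ge0 => //.
  have k1 := @kap_ge1 R.
  have c8 : 0 <= 8 / @cw R by apply: divr_ge0 => //; exact/ltW/cw_gt0.
  have ln0 : 0 <= ln (n%:R / s%:R) :> R.
    by apply: ln_ge0; rewrite ler_pdivlMr ?mul1r ?ler_nat ?ltr0n.
  by clear -k1 c8 ln0; lra.
pose C : R := Cn * expR (m * s%:R / 4).
have C0 : 0 <= C by apply: mulr_ge0; [exact/ltW/Cn_gt0|exact: expR_ge0].
have lE : l * s%:R / alpha = m * s%:R / 4 by rewrite /l; field; rewrite gt_eqF.
pose N : R := Cn * (520 * Kwide * (alpha * T)).
pose B : R := C * (expR 1 * (64 * Kwide)).
have hf (k : 'I_n * bool) i :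
    intble (fun y => phi (y - theta i) * fac theta alpha l D C k i y) /\
    I (fun y => phi (y - theta i) * fac theta alpha l D C k i y) <= mom theta D N B x k i.
  rewrite /fac /mom; case: k => k [] /=; case: eqP => _.
  - exact: add_fac_moment iz Iz.
  - under eq_fun do rewrite mulr1.
    by rewrite I_phi; split => //; exact: intble_phi.
  - exact: dev_fac_moment C0 iq Iq.
  - exact: tilt_moment ie Ie.
apply: (@le_trans _ _ (\sum_(k : 'I_n * bool) \prod_(i < n) mom theta D N B x k i)%:E).
  apply: (Eth_le _ _ (fun k i => (hf k i).1) (fun k i => (hf k i).2)).
  - move=> X; apply: sume_ge0 => i _; apply: post_sq_ge0.
    have [/andP[h2 ->] _] := ha X; rewrite andbT.
    exact: le_trans (ltW an0) h2.
  - by move=> k i y; exact: fac_ge0.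
  - move=> X; have [/andP[b0 b1] hb] := ha X.
    have hla : loglik n alpha X <= loglik n (ahat X) X by apply: hb; rewrite ana.
    apply: le_trans (risk_le s0 sn a0 a1 (lt_le_trans an0 b0) b1 hs l0 hla _) _.
      by move=> a /andP[h2 h3]; apply: hb; rewrite h3 (le_trans b0).
    rewrite lee_fin -sum_fac lerD2l lE le_eqVlt; apply/orP; left; apply/eqP.
    by apply: eq_bigr => i _; rewrite /C; ring.
rewrite lee_fin; apply: le_trans (sum_mom_le D hs _ _ x0) _.
- apply: mulr_ge0; first exact/ltW/Cn_gt0.
  apply: mulr_ge0; first by apply: mulr_ge0; [exact: ler0n|exact/ltW/Kwide_gt0].
  by apply: mulr_ge0; [exact: ltW|clear -T1; lra].
- apply: mulr_ge0 => //; apply: mulr_ge0; first exact: expR_ge0.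
  by apply: mulr_ge0; [exact: ler0n|exact/ltW/Kwide_gt0].
by rewrite (_ : n%:R * D = s%:R * Cs (n%:R / s%:R)) // /D mulrC divfK ?gt_eqF.
Qed.

End Core.

(** * Choice of the comparison weight *)

Section Final.
Context {R : realType}.
Implicit Types (theta X : nat -> R) (n s : nat).

Lemma cg_le1 : @cg R <= 1.
Proof. by rewrite /cg invf_le1; have := @Kwide_gt0 R; have := @pi_ge1 R; nra. Qed.

Definition Kwgt : R := 160 / cg.
(** The three summands serve [trunc_ge1], [wgt_ub] and [wgt_trunc] respectively. *)
Definition lnmin : R := 1 + 1280 * Kwgt / cg + 2 / cw.
Definition clog : R := 240 / cg.
(** The terms up to [2 * Cm] come from the signals, where 32 joins the constant 16 and the factor 16
    of the logarithm in [Cs]; 4160 is [520 * 8] from [trunc ^ 2 = 8 ln]; the last term is the event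
    of a large weight. *)
Definition Crisk : R :=
  16 / cw + 32 + 16 * kap + 128 * Kwide + 2 * Cm + 4160 * Cn * Kwide * Kwgt
  + Cn * (expR 1 * (64 * Kwide)).

Lemma Kwgt_ge1 : 160 <= Kwgt.
Proof. by rewrite /Kwgt ler_pdivlMr ?cg_gt0//; have := cg_le1; lra. Qed.

Lemma clog_ge1 : 240 <= clog.
Proof. by rewrite /clog ler_pdivlMr ?cg_gt0//; have := cg_le1; lra. Qed.

Lemma lnmin_ge1 : 1 <= lnmin.
Proof.
have h1 : 0 <= 1280 * Kwgt / cg.
  apply: divr_ge0; last exact/ltW/cg_gt0.
  by apply: mulr_ge0; [lra|have := Kwgt_ge1; lra].
have h2 : 0 <= 2 / @cw R by apply: divr_ge0 => //; exact/ltW/cw_gt0.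
by rewrite /lnmin; lra.
Qed.

(** At [t = sqrt (2 ln n)] one has [phi t <= 1 / n], while [gconv t] is at least of order
    [1 / ln n]; [threshold_ub] compares the two. *)
Lemma alphan_ub n (alphan : R) : 1 <= ln n%:R :> R -> 0 <= alphan <= 1 ->
  is_threshold alphan (Num.sqrt (2 * ln (n%:R))) ->
  alphan <= 6 / cg * ln n%:R / n%:R.
Proof.
set L := ln _ => L1 aI /(threshold_ub aI); set t := Num.sqrt _ => h.
have n0 : 0 < n%:R :> R.
  rewrite lt_neqAle ler0n andbT eq_sym; apply/eqP => n0.
  by move: L1; rewrite /L n0 ln0//; lra.
have t2 : t ^+ 2 = 2 * L by rewrite sqr_sqrtr//; lra.
have c0 := @cg_gt0 R.
have hp : phi t <= n%:R^-1.
  have s1 := @sqrt2pi_ge1 R.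
  rewrite /phi t2 (_ : - (2 * L) / 2 = - L); last by field.
  rewrite expRN lnK ?posrE// ler_pdivrMr; last lra.
  by rewrite ler_peMr// invr_ge0 ltW.
have hg := gconv_lb t; rewrite t2 in hg.
have hg2 : cg / (3 * L) <= gconv t.
  by apply: le_trans hg; rewrite ler_pM2l// lef_pV2 ?posrE; lra.
have /andP[a0 _] := aI.
have h3 : alphan * (cg / (3 * L)) <= 2 * n%:R^-1.
  apply: le_trans (_ : alphan * gconv t <= _); first by rewrite ler_wpM2l.
  by apply: le_trans h _; rewrite ler_pM2l.
have -> : 6 / cg * L / n%:R = 2 * n%:R^-1 / (cg / (3 * L)).
  by field; rewrite !gt_eqF//; lra.
by rewrite ler_pdivlMr// divr_gt0//; lra.
Qed.

(* T and alpha of the header, at y = n/s. *)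
Definition trunc (y : R) : R := Num.sqrt (8 * ln y).
Definition wgt (y : R) : R := Kwgt * trunc y / y.

Lemma trunc_sqr (y : R) : lnmin <= ln y -> trunc y ^+ 2 = 8 * ln y.
Proof. by have := lnmin_ge1 => ? ?; rewrite sqr_sqrtr//; lra. Qed.

Lemma trunc_ge1 (y : R) : lnmin <= ln y -> 1 <= trunc y.
Proof. by have := lnmin_ge1 => ? ?; rewrite -sqrtr1 ler_wsqrtr//; lra. Qed.

Lemma ratio_gt0 (y : R) : lnmin <= ln y -> 0 < y.
Proof.
have := lnmin_ge1 => h1 h2; rewrite ltNge; apply/negP => y0.
by move: h2; rewrite ln0//; lra.
Qed.

Lemma ln_ge_Kwgt (y : R) : lnmin <= ln y -> 1280 * Kwgt <= ln y * cg.
Proof.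
have h2 : 0 <= 2 / @cw R by apply: divr_ge0 => //; exact/ltW/cw_gt0.
by rewrite -ler_pdivrMr ?cg_gt0// /lnmin; lra.
Qed.

Lemma ln_ge_cw (y : R) : lnmin <= ln y -> 2 <= ln y * cw.
Proof.
have h1 : 0 <= 1280 * Kwgt / cg.
  apply: divr_ge0; last exact/ltW/cg_gt0.
  by apply: mulr_ge0; [lra|have := Kwgt_ge1; lra].
by rewrite -ler_pdivrMr ?cw_gt0// /lnmin; lra.
Qed.

Lemma ratio_gt_ln (y : R) : lnmin <= ln y -> 1 + ln y <= y.
Proof. by move=> h; rewrite -[leRHS](lnK (ratio_gt0 h)) expR_ge1Dx. Qed.

Lemma ratio_ge4 (y : R) : lnmin <= ln y -> 4 <= y.
Proof.
move=> h; have := ratio_gt_ln h; have := ln_ge_Kwgt h; have := Kwgt_ge1.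
have := cg_le1; have := @cg_gt0 R; have := lnmin_ge1; nra.
Qed.

Lemma wgt_lb (y : R) : lnmin <= ln y -> expR (- (trunc y ^+ 2 / 8)) <= wgt y.
Proof.
move=> h; rewrite trunc_sqr// (_ : 8 * ln y / 8 = ln y); last by field.
have y0 := ratio_gt0 h; rewrite expRN lnK// /wgt.
by have := trunc_ge1 h; have := Kwgt_ge1 => *; rewrite ler_peMl ?invr_ge0 ?(ltW y0)//; nra.
Qed.

Lemma wgt_ub (y : R) : lnmin <= ln y -> wgt y <= cg / (40 * trunc y).
Proof.
move=> h; have y0 := ratio_gt0 h; have t1 := trunc_ge1 h; have cg0 := @cg_gt0 R.
rewrite /wgt ler_pdivrMr// [leRHS]mulrAC ler_pdivlMr; last lra.
rewrite (_ : Kwgt * trunc y * (40 * trunc y) = 40 * Kwgt * trunc y ^+ 2); last by ring.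
rewrite trunc_sqr//; have zK := ln_ge_Kwgt h; have z1 := lnmin_ge1; set z := ln y in h zK *.
(* Square [z / 2 <= exp (z / 2)]. A quadratic bound suffices, since [z] exceeds the constant
   [1280 Kwgt / cg]. *)
have zy2 : z ^+ 2 / 4 <= y.
  rewrite -(lnK y0) -/z (_ : z = z / 2 + z / 2) ?expRD; last lra.
  rewrite (_ : _ ^+ 2 / 4 = z / 2 * (z / 2)); last by field.
  by have := expR_ge1Dx (z / 2) => e; apply: ler_pM; lra.
have : 1280 * Kwgt * z <= z * cg * z by rewrite ler_pM2r//; lra.
have : cg * (z ^+ 2 / 4) <= cg * y by rewrite ler_pM2l.
lra.
Qed.

Lemma wgt_le_half (y : R) : lnmin <= ln y -> wgt y <= 1 / 2.
Proof.
move=> h; apply: le_trans (wgt_ub h) _; have t1 := trunc_ge1 h.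
by rewrite ler_pdivrMr; have := cg_le1; lra.
Qed.

Lemma wgt_trunc (y : R) : lnmin <= ln y -> 2 <= wgt y * (cw * expR (trunc y ^+ 2 / 4)).
Proof.
move=> h; have y0 := ratio_gt0 h; have t1 := trunc_ge1 h; have k1 := Kwgt_ge1.
rewrite trunc_sqr// (_ : 8 * ln y / 4 = ln y + ln y); last by field.
rewrite expRD lnK// (_ : _ * _ = Kwgt * trunc y * (y * cw)); last first.
  by rewrite /wgt; field; rewrite gt_eqF.
have : ln y * cw <= y * cw by rewrite ler_pM2r ?cw_gt0//; have := ratio_gt_ln h; lra.
have := ln_ge_cw h; have : 1 <= Kwgt * trunc y by nra.
nra.
Qed.

(* Kwgt makes the Chernoff exponent twice the cost m s / 4 of the signals, and
   clog makes what is left beat n. *)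
Lemma chernoff_tail (y sr L m : R) : lnmin <= ln y -> 1 <= sr -> 1 <= L -> ln y <= L ->
  clog * L ^+ 2 <= sr -> m = cg / (20 * trunc y) ->
  L + (m * sr / 4 - m * wgt y / 4 * m / 2 * (y * sr - sr - 1)) <= 0.
Proof.
move=> h s1 L1 zL hs mE; have t1 := trunc_ge1 h; have cg0 := @cg_gt0 R.
have y4 := ratio_ge4 h; have k1 := Kwgt_ge1.
have m0 : 0 < m by rewrite mE divr_gt0//; lra.
have x0 : 0 <= m * wgt y / 4 * m / 2.
  have a0 : 0 <= wgt y by apply: divr_ge0; [apply: mulr_ge0|]; lra.
  apply: divr_ge0 => //; apply: mulr_ge0; last exact: ltW.
  by apply: divr_ge0 => //; apply: mulr_ge0 => //; exact: ltW.
(* Uses [y >= 4] and [sr >= 1]. *)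
have hn : y * sr / 2 <= y * sr - sr - 1 by nra.
have := ler_wpM2l x0 hn.
have -> : m * wgt y / 4 * m / 2 * (y * sr / 2) = m * sr / 2.
  by rewrite mE /wgt /Kwgt; field; rewrite !gt_eqF//; lra.
suff : L <= m * sr / 4 by lra.
(* From [8 ln y <= 9 L^2]; then [80 * 3] is the 240 of [clog]. *)
have T3 : trunc y <= 3 * L.
  by rewrite -(@ler_sqr _ (trunc y)) ?nnegrE ?trunc_sqr//; [nra|lra|lra].
rewrite (_ : m * sr / 4 = cg * sr / (80 * trunc y)); last first.
  by rewrite mE; field; rewrite gt_eqF//; lra.
rewrite ler_pdivlMr; last lra.
have : cg * (clog * L ^+ 2) <= cg * sr by rewrite ler_pM2l.
have -> : cg * (clog * L ^+ 2) = 240 * L ^+ 2 by rewrite /clog; field; rewrite gt_eqF.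
have : 80 * (L * trunc y) <= 80 * (L * (3 * L)) by rewrite ler_pM2l// ler_pM2l//; lra.
lra.
Qed.

(** Puts the comparison weight in the range of the maximisation: [alphan] is at most of order
    [ln n / n], while [wgt] is of order [s T / n] with [T >= 1] and [s >= ln n]. *)
Lemma alphan_le_wgt (n s : nat) (alphan : R) : (0 < s)%N ->
  lnmin <= ln (n%:R / s%:R) -> 1 <= ln n%:R :> R -> ln n%:R <= s%:R :> R ->
  0 <= alphan <= 1 -> is_threshold alphan (Num.sqrt (2 * ln (n%:R))) ->
  alphan <= wgt (n%:R / s%:R).
Proof.
move=> s0 h L1 Ls aI ht; apply: le_trans (alphan_ub L1 aI ht) _.
have cg0 := @cg_gt0 R; have t1 := trunc_ge1 h; have k1 := Kwgt_ge1.
have n0 : 0 < n%:R :> R by rewrite lt_neqAle ler0n andbT eq_sym; apply: contraTneq L1 => ->;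
  rewrite ln0// -ltNge.
rewrite /wgt invf_div mulrA ler_pM2r ?invr_gt0//.
set T := trunc _ in t1 *; set L := ln _ in L1 Ls *.
have -> : 6 / cg * L = 6 / 160 * (Kwgt * L) by rewrite /Kwgt; field; rewrite gt_eqF.
have : Kwgt * L <= Kwgt * s%:R by rewrite ler_pM2l//; lra.
have : Kwgt * s%:R <= Kwgt * T * s%:R by rewrite -mulrA ler_pM2l ?ler_peMl//; lra.
have : 0 <= Kwgt * L by apply: mulr_ge0; lra.
lra.
Qed.

Lemma risk_le_rate n s theta (ahat : (nat -> R) -> R) (alphan : R) :
  (0 < s)%N -> lnmin <= ln (n%:R / s%:R) -> clog * ln n%:R ^+ 2 <= s%:R ->
  in_l0 n s theta ->
  0 <= alphan <= 1 -> is_threshold alphan (Num.sqrt (2 * ln (n%:R))) ->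
  (forall X, alphan <= ahat X <= 1 /\
     forall a, alphan <= a <= 1 -> loglik n a X <= loglik n (ahat X) X) ->
  (Eth n theta (fun X => post_risk n (ahat X) theta X) <=
    (Crisk * (s%:R * ln (n%:R / s%:R)))%:E)%E.
Proof.
move=> s0 hz hs hl aI ht ha.
have sR1 : 1 <= s%:R :> R by rewrite ler1n.
have sR0 : 0 < s%:R :> R by rewrite ltr0n.
have y0 := ratio_gt0 hz; have y4 := ratio_ge4 hz.
have nE : n%:R = n%:R / s%:R * s%:R :> R by rewrite divfK// gt_eqF.
have n0 : 0 < n%:R :> R by rewrite nE mulr_gt0.
have sn : (s <= n)%N.
  by rewrite -(ler_nat R) [leRHS]nE ler_peMl//; lra.
have z1 : 1 <= ln (n%:R / s%:R) :> R by apply: le_trans hz; exact: lnmin_ge1.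
have zL : ln (n%:R / s%:R) <= ln n%:R :> R.
  by rewrite ler_ln ?posrE// ler_pdivrMr// ler_peMr// ltW.
have L1 : 1 <= ln n%:R :> R by exact: le_trans zL.
have Ls : ln n%:R <= s%:R :> R.
  apply: le_trans hs; have := clog_ge1; set L := ln _ in L1 *; nra.
have an0 : 0 < alphan.
  by rewrite lt_neqAle eq_sym (threshold_gt0 ht); have /andP[] := aI.
have ana := alphan_le_wgt s0 hz L1 Ls aI ht.
apply: le_trans (risk_le_weight s0 sn hl an0 ana (wgt_le_half hz) ha (trunc_ge1 hz) (wgt_lb hz)
  (wgt_trunc hz) (wgt_ub hz) erefl) _.
rewrite lee_fin; clear ha ht aI hl ana an0.
have T2 := trunc_sqr hz.
have tail := chernoff_tail hz sR1 L1 zL hs erefl; rewrite -nE in tail.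
set y := n%:R / s%:R in hz y0 y4 nE z1 zL T2 tail *.
set m := cg / (20 * trunc y) in tail *.
have K0 := @Kwide_gt0 R; have Cn0 := @Cn_gt0 R; have cw0 := @cw_gt0 R.
have Cm0 := @Cm_gt0 R; have kap1 := @kap_ge1 R.
rewrite /Crisk [leRHS]mulrDl; apply: lerD; first (rewrite [leRHS]mulrDl; apply: lerD).
- clear tail; rewrite -mulrDr addrA [leRHS]mulrCA ler_pM2l// /Cs; set z := ln _ in z1 *.
  have h3 : 0 <= 16 / @cw R by apply: divr_ge0 => //; exact: ltW.
  have : 0 <= (16 / cw + 16 + 16 * kap + 128 * Kwide + 2 * Cm) * (z - 1).
    by apply: mulr_ge0; lra.
  lra.
- rewrite (_ : wgt y * trunc y = Kwgt * trunc y ^+ 2 / y); last by rewrite /wgt; ring.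
  rewrite T2 le_eqVlt; apply/orP; left; apply/eqP.
  by rewrite nE; field; rewrite gt_eqF.
rewrite (_ : n%:R * _ = Cn * (expR 1 * (64 * Kwide)) *
   (n%:R * (expR (m * s%:R / 4) * expR (- (m * wgt y / 4 * m / 2 * (n%:R - s%:R - 1))))));
  last by ring.
apply: ler_pM => //.
  by apply: mulr_ge0; [exact: ltW|apply: mulr_ge0; [exact: expR_ge0|lra]].
(* By [chernoff_tail] the factor [n] and the two exponentials multiply to at most 1, which is below
   [s ln (n / s)]. *)
apply: (@le_trans _ _ 1); last by rewrite -[leLHS]mulr1; apply: ler_pM.
by rewrite -expRD -{1}(lnK (n0 : n%:R \is Num.pos)) -expRD -[leRHS]expR0 ler_expR.
Qed.

End Final.

(** * Choice of constants and the two sparsity ranges *)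

Theorem theorem3 (R : realType) :
  exists (C : R) (N0 : nat) (c0 c1 : R),
    0 < C /\ (0 < N0)%N /\ 0 < c0 /\ 0 < c1 /\
    forall (n : nat), (N0 <= n)%N ->
    forall (alphan : R), 0 <= alphan <= 1 ->
      is_threshold alphan (Num.sqrt (2 * ln (n%:R))) ->
    forall (ahat : (nat -> R) -> R),
      (forall X, alphan <= ahat X <= 1 /\
         forall alpha, alphan <= alpha <= 1 -> loglik n alpha X <= loglik n (ahat X) X) ->
    forall (s : nat),
      ((c1 * ln (n%:R) ^+ 2 <= s%:R <= c0 * n%:R ->
        forall theta0, in_l0 n s theta0 ->
          (Eth n theta0 (fun X => post_risk n (ahat X) theta0 X)
             <= (C * @rate R n s)%:E)%E)
      /\
      ((1 <= s)%N -> s%:R <= c0 * n%:R ->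
        forall theta0, in_l0 n s theta0 ->
          (Eth n theta0 (fun X => post_risk n (ahat X) theta0 X)
             <= (C * @rate R n s + C * ln (n%:R) ^+ 3)%:E)%E)).
Proof.
have cl := @clog_ge1 R; have zl := @lnmin_ge1 R.
have A0 : 0 <= @Crisk R.
  have K0 := @Kwide_gt0 R; have Cm0 := @Cm_gt0 R; have Cn0 := @Cn_gt0 R.
  have k1 := @Kwgt_ge1 R; have kap1 := @kap_ge1 R.
  have : 0 <= 16 / @cw R by apply: divr_ge0 => //; exact/ltW/cw_gt0.
  have : 0 <= 4160 * @Cn R * Kwide * Kwgt.
    apply: mulr_ge0; last lra.
    apply: mulr_ge0; last exact: ltW.
    by apply: mulr_ge0; [lra|exact: ltW].
  have : 0 <= @Cn R * (expR 1 * (64 * Kwide)).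
    by rewrite mulr_ge0 ?(ltW Cn0)// mulr_ge0 ?expR_ge0//; lra.
  by rewrite /Crisk; lra.
(* Turns [s <= c0 n] into [ln (n / s) >= lnmin]. *)
pose c0 : R := expR (- lnmin).
have c00 : 0 < c0 by exact: expR_gt0.
(* Chosen so that [L >= w] gives [(clog + 1) L^2 <= c0 L^3 / 27], which keeps the enlarged sparsity
   [s'] below [c0 n]. *)
pose w : R := 27 * (@clog R + 1) / c0.
have w0 : 0 < w by rewrite /w divr_gt0//; lra.
pose N0 := (Num.truncn (expR (1 + w))).+1.
(* The factor [clog + 1] covers the size of [s']; the added 1 in the other factor makes [C]
   positive. *)
pose C : R := (@Crisk R + 1) * (@clog R + 1).
have C0 : 0 < C by rewrite /C mulr_gt0//; lra.
exists C, N0, c0, (@clog R); do 2 split => //; split => //; split; first lra.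
move=> n nN alphan aI ht ahat ha.
have nR : expR (1 + w) <= n%:R.
  have /andP[_ h] := Num.Theory.truncn_itv (expR_ge0 (1 + w)).
  by apply: (le_trans (ltW h)); rewrite ler_nat.
have n0 : 0 < n%:R :> R by apply: lt_le_trans nR; exact: expR_gt0.
have Lw : 1 + w <= ln n%:R by rewrite -[leLHS]expRK ler_ln ?posrE ?expR_gt0.
set L := ln n%:R in Lw *.
have nE : n%:R = expR L by rewrite lnK.
have lnsE (s : nat) : (0 < s)%N -> s%:R <= c0 * n%:R -> @lnmin R <= ln (n%:R / s%:R).
  move=> s0 sc; have sR : 0 < s%:R :> R by rewrite ltr0n.
  rewrite -[leLHS]expRK ler_ln ?posrE ?expR_gt0 ?divr_gt0// ler_pdivlMr//.
  have : expR lnmin * s%:R <= expR lnmin * (c0 * n%:R) by rewrite ler_pM2l ?expR_gt0.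
  by rewrite mulrA /c0 -expRD subrr expR0 mul1r.
have bnd (s : nat) theta0 : (0 < s)%N -> @clog R * L ^+ 2 <= s%:R -> s%:R <= c0 * n%:R ->
    in_l0 n s theta0 ->
    (Eth n theta0 (fun X => post_risk n (ahat X) theta0 X) <=
      (Crisk * (s%:R * ln (n%:R / s%:R)))%:E)%E.
  by move=> s0 h1 h2 hl; apply: risk_le_rate hl aI ht ha => //; exact: lnsE.
have rate0 (s : nat) : (0 < s)%N -> s%:R <= c0 * n%:R -> 0 <= s%:R * ln (n%:R / s%:R) :> R.
  by move=> s0 h; rewrite mulr_ge0//; have := lnsE _ s0 h; lra.
have part1 (s : nat) theta0 : (0 < s)%N -> @clog R * L ^+ 2 <= s%:R -> s%:R <= c0 * n%:R ->
    in_l0 n s theta0 ->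
    (Eth n theta0 (fun X => post_risk n (ahat X) theta0 X) <=
      (C * rate R n s)%:E)%E.
  move=> s0 h1 h2 hl; apply: le_trans (bnd _ _ s0 h1 h2 hl) _.
  rewrite lee_fin (_ : C * rate R n s = 2 * C * (s%:R * ln (n%:R / s%:R))); last by rewrite /rate; ring.
  have := rate0 _ s0 h2.
  by move=> r0; apply: ler_wpM2r => //; rewrite /C; nra.
move=> s; split.
  move=> /andP[h1 h2] theta0 hl; apply: part1 => //.
  rewrite -(ltr0n R); apply: lt_le_trans h1; rewrite mulr_gt0 ?exprn_gt0//; lra.
move=> s0 sc theta0 hl.
have L3 : 0 <= C * L ^+ 3 by rewrite mulr_ge0 ?(ltW C0)// exprn_ge0//; lra.
have [h1|h1] := leP (@clog R * L ^+ 2) s%:R.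
  by apply: le_trans (part1 _ _ s0 h1 sc hl) _; rewrite lee_fin lerDl.
have cL0 : 0 <= @clog R * L ^+ 2 by rewrite mulr_ge0 ?sqr_ge0//; lra.
have /andP[t1 t2] := Num.Theory.truncn_itv cL0.
(* The first integer above [clog L^2]. It exceeds [s] here, so [theta0] is also [s']-sparse, and it
   is at most [(clog + 1) L^2] because [L >= 1]. *)
set s' := (Num.truncn (@clog R * L ^+ 2)).+1 in t2.
have ss : (s <= s')%N by rewrite -(ler_nat R) (le_trans (ltW h1))// ltW.
have s'c : s'%:R <= (@clog R + 1) * L ^+ 2 by rewrite -natr1; nra.
have s'n : s'%:R <= c0 * n%:R.
  apply: le_trans s'c _.
  (* Cube [L / 3 <= exp (L / 3)]. *)
  have e3 : L ^+ 3 / 27 <= n%:R.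
    rewrite nE (_ : L = L / 3 + L / 3 + L / 3) ?expRD; last by lra.
    have := expR_ge1Dx (L / 3); rewrite (_ : _ ^+ 3 / 27 = L / 3 * (L / 3) * (L / 3)); last by field.
    move=> h; have L30 : 0 <= L / 3 by lra.
    have L3e : L / 3 <= expR (L / 3) by lra.
    by apply: ler_pM => //; [exact: mulr_ge0|exact: ler_pM].
  apply: (@le_trans _ _ (c0 * (L ^+ 3 / 27))); last by rewrite ler_pM2l.
  have wL : 27 * (@clog R + 1) <= L * c0 by rewrite -ler_pdivrMr// -/w; lra.
  rewrite (_ : c0 * (L ^+ 3 / 27) = (L * c0) / 27 * L ^+ 2); last by ring.
  by rewrite ler_wpM2r ?sqr_ge0//; lra.
have hl' : in_l0 n s' theta0 by exact: leq_trans hl ss.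
apply: le_trans (bnd _ _ (ltn0Sn _) (ltW t2) s'n hl') _; rewrite lee_fin.
have lz : ln (n%:R / s'%:R) <= L.
  rewrite ler_ln ?posrE ?divr_gt0// ?ltr0n//.
  by rewrite ler_pdivrMr ?ltr0n// ler_peMr ?(ltW n0)// ler1n.
have r0 := rate0 _ (ltn0Sn _) s'n; have r1 := rate0 _ s0 sc.
have h2 : s'%:R * ln (n%:R / s'%:R) <= (@clog R + 1) * L ^+ 2 * L.
  apply: (@le_trans _ _ (s'%:R * L)); first by rewrite ler_wpM2l.
  by rewrite ler_wpM2r//; lra.
have h3 : Crisk * (s'%:R * ln (n%:R / s'%:R)) <= Crisk * ((@clog R + 1) * L ^+ 2 * L).
  by rewrite ler_wpM2l.
have h4 : 0 <= C * rate R n s.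
  by rewrite mulr_ge0 ?(ltW C0)// /rate -mulrA mulr_ge0.
have h5 : 0 <= (@clog R + 1) * L ^+ 3 by rewrite mulr_ge0 ?exprn_ge0//; lra.
rewrite (_ : C * L ^+ 3 = Crisk * ((@clog R + 1) * L ^+ 2 * L) + (@clog R + 1) * L ^+ 3);
  last by rewrite /C; ring.
by apply: le_trans h3 _; rewrite addrCA lerDl addr_ge0.
Qed.
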